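(* Let $n\ge2$, let $L$ be an algebraically closed field, and let $G$ be a connected semisimple linear algebraic subgroup of $\mathrm{SL}_{n,L}$. Assume that the tautological representation of $G$ on $L^n$ is irreducible and that the morphism $f$ does not vanish identically on $G$. Then $G=\mathrm{SL}_{n,L}$.
   Context: The morphism $f:\mathrm{GL}_{n,L}\to\mathbb{A}^1_L$ is defined as follows. Consider the symmetric polynomial with integer coefficients in variables $\alpha_1,\dots,\alpha_n$ $$\prod_{i_1,i_2}(\alpha_{i_1}-\alpha_{i_2})\cdot\prod_{i_1,i_2,i_3}(\alpha_{i_1}\alpha_{i_2}-\alpha_{i_3}^2)\cdot\prod_{i_1,\dots,i_4}(\alpha_{i_1}\alpha_{i_2}-\alpha_{i_3}\alpha_{i_4})\cdot\prod_{i_1,\dots,i_6}(\alpha_{i_1}\alpha_{i_2}\alpha_{i_3}-\alpha_{i_4}\alpha_{i_5}\alpha_{i_6}),$$ where each product runs over all tuples of pairwise distinct indices in $\{1,\dots,n\}$ (empty products equal 1). Write it as an integral polynomial in the coefficients $\beta_1,\dots,\beta_n$ of $\prod_i(T-\alpha_i)=T^n+\beta_1T^{n-1}+\dots+\beta_n$, and apply it to the coefficients of the characteristic polynomial of $\gamma\in\mathrm{GL}_n$. Thus $f(\gamma)$ is this expression evaluated at the eigenvalues of $\gamma$ (with multiplicities). *)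

(* Defs.v *)
From HB Require Import structures.
From mathcomp Require Import all_boot all_order all_algebra.
Set Implicit Arguments. Unset Strict Implicit. Unset Printing Implicit Defensive.
Import Order.TTheory GRing.Theory Num.Theory.
Local Open Scope ring_scope.

Section Defs.
Variables (L : closedFieldType) (n : nat).
Local Notation M := ('M[L]_n).

Inductive polyfun : (M -> L) -> Prop :=
| pf_const (c : L) : polyfun (fun _ => c)
| pf_coord (i j : 'I_n) : polyfun (fun A => A i j)
| pf_add f g : polyfun f -> polyfun g -> polyfun (fun A => f A + g A)
| pf_mul f g : polyfun f -> polyfun g -> polyfun (fun A => f A * g A).

Definition zclosed (S : M -> Prop) : Prop :=
  exists P : (M -> L) -> Prop, (forall p, P p -> polyfun p) /\
    (forall A, S A <-> (forall p, P p -> p A = 0)).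

Definition zconnected (S : M -> Prop) : Prop :=
  forall C1 C2 : M -> Prop, zclosed C1 -> zclosed C2 ->
    (forall A, S A -> C1 A \/ C2 A) ->
    (forall A, ~ (S A /\ C1 A /\ C2 A)) ->
    (forall A, S A -> C1 A) \/ (forall A, S A -> C2 A).

Definition subgroup (S : M -> Prop) : Prop :=
  [/\ S 1%:M,
      (forall A B, S A -> S B -> S (A *m B)) &
      (forall A, S A -> A \in unitmx /\ S (invmx A))].

Definition alg_subgroup_SL (S : M -> Prop) : Prop :=
  [/\ subgroup S, zclosed S & forall A, S A -> \det A = 1].

Definition commutator (A B : M) : M := invmx A *m invmx B *m A *m B.

Definition derived (S : M -> Prop) : M -> Prop :=
  fun C => forall H, subgroup H ->
    (forall A B, S A -> S B -> H (commutator A B)) -> H C.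

Fixpoint derived_iter (k : nat) (S : M -> Prop) : M -> Prop :=
  if k is k'.+1 then derived (derived_iter k' S) else S.

Definition solvable_grp (S : M -> Prop) : Prop :=
  exists k, forall A, derived_iter k S A -> A = 1%:M.

Definition normal_in (H G : M -> Prop) : Prop :=
  (forall A, H A -> G A) /\
  forall g h, G g -> H h -> H (invmx g *m h *m g).

(* semisimple: the radical (largest connected solvable closed normal
   subgroup) is trivial, i.e. every such subgroup is trivial *)
Definition semisimple (G : M -> Prop) : Prop :=
  forall H, subgroup H -> zclosed H -> zconnected H -> normal_in H G ->
    solvable_grp H -> forall A, H A -> A = 1%:M.

(* the tautological representation on column vectors L^n is irreducible:
   a subspace W (row space of U, viewed as column vectors via transpose)
   stable under all g in G is 0 or everything *)
Definition taut_irreducible (G : M -> Prop) : Prop :=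
  forall U : M, (forall g, G g -> (U *m g^T <= U)%MS) ->
    U = 0 \/ row_full U.

Definition eigs (A : M) : seq L := sval (closed_field_poly_normal (char_poly A)).

Definition Fsym (s : seq L) : L :=
  let a k (t : {ffun 'I_k.+1 -> 'I_n}) (j : nat) := s`_(t (inord j)) in
  (\prod_(t : {ffun 'I_2 -> 'I_n} | injectiveb t) (a _ t 0 - a _ t 1)) *
  (\prod_(t : {ffun 'I_3 -> 'I_n} | injectiveb t)
      (a _ t 0 * a _ t 1 - a _ t 2 ^+ 2)) *
  (\prod_(t : {ffun 'I_4 -> 'I_n} | injectiveb t)
      (a _ t 0 * a _ t 1 - a _ t 2 * a _ t 3)) *
  (\prod_(t : {ffun 'I_6 -> 'I_n} | injectiveb t)
      (a _ t 0 * a _ t 1 * a _ t 2 - a _ t 3 * a _ t 4 * a _ t 5)).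

Definition fmorph (A : M) : L := Fsym (eigs A).

End Defs.

(* Main.v *)
Require Import Defs.
From HB Require Import structures.
From mathcomp Require Import all_boot all_order all_algebra all_fingroup.
From mathcomp Require Import mpoly ring.
From Stdlib Require Import Classical ClassicalEpsilon FunctionalExtensionality.
Set Implicit Arguments. Unset Strict Implicit. Unset Printing Implicit Defensive.
Import Order.TTheory GRing.Theory Num.Theory.
Local Open Scope ring_scope.

(** Being connected, G is irreducible as a variety, so some g in G satisfies both
    [fmorph g != 0] and [a_i + a_j != 0] for its eigenvalues a_1, ..., a_n.  Diagonalize g.
    The ratios a_i / a_j (i <> j) are then pairwise distinct and different from 1, so
    that every Ad(g)-stable subspace of gl_n is spanned by its diagonal part and by some
    of the E_ij.  This applies to the Zariski tangent space T of G at 1, which is even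
    Ad(G)-stable.

    T does not consist of scalars: otherwise G is locally a curve near g, the zero g of a
    nonconstant function [h |-> c(h) - c(g)], c a coefficient of the characteristic
    polynomial, is isolated, hence g commutes with a neighbourhood of 1 in G, hence with G,
    which contradicts irreducibility.  A nonscalar element of T has a nondiagonal
    conjugate, so T contains some E_ij; as no matrix entry vanishes identically
    on G, the conjugates of E_ij have nonzero (k,l) entries for all k <> l, so T contains all
    E_kl; and a matrix orthogonal to all conjugates of the E_kl is scalar, so T contains sl_n.

    Finally G is all of SL_n: on SL_n one coordinate is a rational function of the others, and
    a nonzero polynomial q of minimal degree in these, vanishing on G, would have all its
    partial derivatives zero, hence be constant or a p-th power of a smaller one. *)

(** * Hilbert basis theorem *)

(** Induct on the set [F] of coordinates that may vary in [Q]. Fix [m0] in [Q]: a member not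
    divisible by [m0] has [m i < m0 i] for some [i] in [F], so it lies in one of finitely many
    slices [m i = v], each with one varying coordinate fewer. *)
Lemma dickson N (P : 'X_{1..N} -> Prop) :
  exists s : seq 'X_{1..N}, (forall m, m \in s -> P m) /\
    forall m, P m -> exists2 m', m' \in s & (m' <= m)%MM.
Proof.
suff gen k (F : {set 'I_N}) (Q : 'X_{1..N} -> Prop) : (#|F| < k)%N ->
    (forall m m', Q m -> Q m' -> forall i, i \notin F -> m i = m' i) ->
    exists s : seq 'X_{1..N}, (forall m, m \in s -> Q m) /\
      forall m, Q m -> exists2 m', m' \in s & (m' <= m)%MM.
  by apply: (gen _ setT P (ltnSn _)) => m m' _ _ i; rewrite inE.
elim: k F Q => [|k IH] F Q //; rewrite ltnS => Fk agree.
case: (classic (exists m, Q m)) => [[m0 Qm0]|none]; last first.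
  by exists [::]; split=> // m Qm; case: none; exists m.
have step i v : exists s : seq 'X_{1..N}, i \in F ->
    (forall m, m \in s -> Q m /\ m i = v) /\
    forall m, Q m /\ m i = v -> exists2 m', m' \in s & (m' <= m)%MM.
  case: (boolP (i \in F)) => [iF|_]; last by exists [::].
  have [||s Hs] := IH (F :\ i) (fun m => Q m /\ m i = v); last by exists s.
    by move: Fk; rewrite (cardsD1 i F) iF.
  move=> m m' [Qm mi] [Qm' m'i] j; rewrite !inE negb_and negbK => /orP[/eqP->|].
    by rewrite mi m'i.
  exact: agree.
pose f i v := sval (constructive_indefinite_description _ (step i v)).
have fP i v (iF : i \in F) :=
  svalP (constructive_indefinite_description _ (step i v)) iF.
exists (m0 :: flatten [seq f i v | i <- enum F, v <- iota 0 (m0 i)]); split.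
  move=> m; rewrite inE => /orP[/eqP->//|/flattenP[s /allpairsPdep[i [v [iF _ ->]]]]].
  by rewrite mem_enum in iF => ms; have [/(_ m ms)[]] := fP i v iF.
move=> m Qm; case: (boolP (m0 <= m)%MM) => [le|]; first by exists m0; rewrite ?mem_head.
case/forallPn => i nle; have lt : (m i < m0 i)%N by rewrite ltnNge.
have iF : i \in F.
  by apply: contraLR lt => /(agree _ _ Qm Qm0) ->; rewrite ltnn.
have [_ /(_ m (conj Qm (erefl _)))[m' m's le]] := fP i (m i) iF.
exists m' => //; rewrite inE; apply/orP; right; apply/flattenP.
exists (f i (m i)) => //; apply/allpairsPdep; exists i, (m i).
by rewrite mem_enum mem_iota iF; split.
Qed.

Section Noetherian.
Variables (L : fieldType) (N : nat).
Local Notation R := {mpoly L[N]}.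

Definition ideal (I : R -> Prop) :=
  [/\ I 0, forall p q, I p -> I q -> I (p + q) & forall a p, I p -> I (a * p)].

(** Dickson's lemma gives finitely many leading monomials that divide all others of [I]; subtracting
    multiples of the chosen [f m] lowers the leading monomial. Generation is phrased as containment
    in every ideal [J] that contains [s], which avoids explicit linear combinations. *)
Lemma hilbert_basis (I : R -> Prop) : ideal I ->
  exists s : seq R, (forall p, p \in s -> I p) /\
    forall J, ideal J -> (forall p, p \in s -> J p) -> forall p, I p -> J p.
Proof.
move=> [I0 ID IM].
have [s [sP sdiv]] := dickson (fun m => exists p, [/\ I p, p != 0 & mlead p = m]).
pose f m := if excluded_middle_informative (m \in s) is left h
  then sval (constructive_indefinite_description _ (sP m h)) else 0.
have fP m : m \in s -> [/\ I (f m), f m != 0 & mlead (f m) = m].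
  rewrite /f => ms; case: excluded_middle_informative => // h.
  exact: (svalP (constructive_indefinite_description _ (sP m h))).
exists (map f s); split=> [p /mapP[m ms ->]|J [J0 JD JM] Js p].
  by case: (fP m ms).
elim/(@mleadrect N L): p => p IHp Ip.
have [->//|p0] := eqVneq p 0.
have [m ms le] := sdiv _ (ex_intro _ p (And3 Ip p0 (erefl _))).
have [If f0 lf] := fP m ms.
pose a := (p@_(mlead p) / (f m)@_m) *: 'X_[mlead p - m] : R.
pose r := p - a * f m.
have Ir : I r by rewrite /r -mulNr; apply: ID => //; apply: IM.
have fm0 : (f m)@_m != 0 by rewrite -[X in _@_X]lf mleadc_eq0.
have c0 : r@_(mlead p) = 0.
  have e : (f m * 'X_[mlead p - m])@_(mlead p) = (f m)@_m.
    by have := mcoeffMX (f m) (mlead p - m)%MM m; rewrite submK.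
  by rewrite mcoeffB /a -scalerAl mcoeffZ (mulrC 'X_[_]) e divfK // subrr.
suff Jr : J r.
  by rewrite -[p](subrK (a * f m)); apply: JD => //; apply/JM/Js/map_f.
have [->//|r0] := eqVneq r 0.
(* Both terms of [r] have leading monomial at most [mlead p], and the coefficient there has
   cancelled. *)
apply: IHp => //; rewrite lt_neqAle; apply/andP; split.
  by apply: contra_neq r0 => e; apply/eqP; rewrite -mleadc_eq0 e c0.
apply: le_trans (mleadB_le _ _) _; rewrite leUx lexx /=.
apply: le_trans (mleadM_le _ _) _; rewrite lf -[X in (_ <= X)%O](submK le).
by rewrite lemc_add2l; apply: le_trans (mleadZ_le _ _) _; rewrite mleadXm.
Qed.

(** The union of the chain is an ideal, and its finitely many generators already lie in one
    [I K]. *)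
Lemma ascending_chain (I : nat -> R -> Prop) :
  (forall k, ideal (I k)) -> (forall k p, I k p -> I k.+1 p) ->
  exists K, forall k p, I k p -> I K p.
Proof.
move=> Iid Iasc.
have mono k l p : (k <= l)%N -> I k p -> I l p.
  by move=> /subnK <-; elim: (l - k)%N => // d IH /IH /Iasc.
have [|s [sU sgen]] := @hilbert_basis (fun p => exists k, I k p).
  split; first by exists 0%N; have [] := Iid 0%N.
    move=> p q [k Ip] [l Iq]; exists (maxn k l); have [_ ID _] := Iid (maxn k l).
    by apply: ID; [apply: mono Ip; apply: leq_maxl | apply: mono Iq; apply: leq_maxr].
  by move=> a p [k Ip]; exists k; have [_ _ IM] := Iid k; apply: IM.
have [K KP] : exists K, forall p, p \in s -> I K p.
  elim: s sU {sgen} => [|q s IH] sU; first by exists 0%N.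
  have [p ps|K KP] := IH; first by apply: sU; rewrite inE ps orbT.
  have [k Iq] := sU q (mem_head _ _); exists (maxn k K) => p.
  rewrite inE => /orP[/eqP->|/KP]; first by apply: mono Iq; apply: leq_maxl.
  by apply: mono; apply: leq_maxr.
by exists K => k p Ip; apply: sgen (Iid K) KP _ _; exists k.
Qed.

End Noetherian.

(** * Polynomial functions and irreducibility *)

Section PolynomialFunctions.
Variables (L : closedFieldType) (n : nat).
Local Notation M := 'M[L]_n.
Implicit Types (f g : M -> L) (p q : {mpoly L[n * n]}) (F H : M -> M).

Lemma polyfun_ext f g : f =1 g -> polyfun f -> polyfun g.
Proof. by move=> /functional_extensionality->. Qed.

Lemma polyfun_opp f : polyfun f -> polyfun (fun A => - f A).
Proof.
move=> pf; apply: (polyfun_ext (f := fun A => -1 * f A)) => [A|].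
  by rewrite mulN1r.
exact: pf_mul (pf_const _ _) pf.
Qed.

Lemma polyfun_sub f g : polyfun f -> polyfun g -> polyfun (fun A => f A - g A).
Proof. by move=> pf /polyfun_opp; apply: pf_add. Qed.

Lemma polyfun_sum (I : Type) (r : seq I) (P : pred I) (f : I -> M -> L) :
  (forall i, P i -> polyfun (f i)) -> polyfun (fun A => \sum_(i <- r | P i) f i A).
Proof.
move=> pf; elim: r => [|i r IH].
  by apply: polyfun_ext (pf_const _ 0) => A; rewrite big_nil.
case Pi: (P i).
  by apply: polyfun_ext (pf_add (pf i Pi) IH) => A; rewrite big_cons Pi.
by apply: polyfun_ext IH => A; rewrite big_cons Pi.
Qed.

Lemma polyfun_prod (I : Type) (r : seq I) (P : pred I) (f : I -> M -> L) :
  (forall i, P i -> polyfun (f i)) -> polyfun (fun A => \prod_(i <- r | P i) f i A).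
Proof.
move=> pf; elim: r => [|i r IH].
  by apply: polyfun_ext (pf_const _ 1) => A; rewrite big_nil.
case Pi: (P i).
  by apply: polyfun_ext (pf_mul (pf i Pi) IH) => A; rewrite big_cons Pi.
by apply: polyfun_ext IH => A; rewrite big_cons Pi.
Qed.

Lemma polyfun_exp f k : polyfun f -> polyfun (fun A => f A ^+ k).
Proof.
move=> pf; apply: (polyfun_ext (f := fun A => \prod_(i < k) f A)) => [A|].
  by rewrite prodr_const card_ord.
exact: polyfun_prod.
Qed.

Definition polymx F := forall i j, polyfun (fun A => F A i j).

Lemma polyfun_comp f F : polyfun f -> polymx F -> polyfun (fun A => f (F A)).
Proof.
move=> pf pF; elim: pf => {f} [c|i j|f g _ pf _ pg|f g _ pf _ pg].
- exact: pf_const.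
- exact: pF.
- exact: pf_add.
- exact: pf_mul.
Qed.

Lemma polymx_const (B : M) : polymx (fun _ => B).
Proof. by move=> i j; apply: pf_const. Qed.

Lemma polymx_id : polymx id.
Proof. by move=> i j; apply: pf_coord. Qed.

Lemma polymx_mul F H : polymx F -> polymx H -> polymx (fun A => F A *m H A).
Proof.
move=> pF pH i j; apply: (polyfun_ext (f := fun A => \sum_k F A i k * H A k j)).
  by move=> A; rewrite mxE.
by apply: polyfun_sum => k _; apply: pf_mul.
Qed.

Lemma polyfun_cofactor i j : polyfun (fun A : M => cofactor A i j).
Proof.
apply: pf_mul; first exact: pf_const.
apply: polyfun_sum => s _; apply: pf_mul; first exact: pf_const.
apply: polyfun_prod => k _.
by apply: polyfun_ext (pf_coord L (lift i k) (lift j (s k))) => A; rewrite !mxE.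
Qed.

Lemma polymx_adj : polymx (fun A => \adj A).
Proof. by move=> i j; apply: polyfun_ext (polyfun_cofactor j i) => A; rewrite mxE. Qed.

(** The variables of [mpoly] are matched with the matrix entries through [mxvec]; this gives access
    to noetherianity and to formal partial derivatives. *)
Definition pev p (A : M) : L := p.@[fun k => mxvec A 0 k].

Lemma pevD p q A : pev (p + q) A = pev p A + pev q A. Proof. exact: mevalD. Qed.
Lemma pevB p q A : pev (p - q) A = pev p A - pev q A. Proof. exact: mevalB. Qed.
Lemma pevM p q A : pev (p * q) A = pev p A * pev q A. Proof. exact: mevalM. Qed.
Lemma pev0 A : pev 0 A = 0. Proof. exact: meval0. Qed.
Lemma pev1 A : pev 1 A = 1. Proof. exact: meval1. Qed.
Lemma pevC c A : pev c%:MP A = c. Proof. exact: mevalC. Qed.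
Lemma pevX p k A : pev (p ^+ k) A = pev p A ^+ k. Proof. exact: rmorphXn. Qed.
Lemma pev_sum (I : Type) (r : seq I) (P : pred I) (p : I -> {mpoly L[n * n]}) A :
  pev (\sum_(i <- r | P i) p i) A = \sum_(i <- r | P i) pev (p i) A.
Proof. exact: raddf_sum. Qed.
Lemma pev_var i j A : pev 'X_(mxvec_index i j) A = A i j.
Proof. by rewrite /pev mevalXU mxvecE. Qed.

Lemma polyfun_mpoly f : polyfun f -> exists p, forall A, pev p A = f A.
Proof.
elim=> [c|i j|g h _ [p pE] _ [q qE]|g h _ [p pE] _ [q qE]].
- by exists c%:MP => A; rewrite pevC.
- by exists 'X_(mxvec_index i j) => A; rewrite pev_var.
- by exists (p + q) => A; rewrite pevD pE qE.
- by exists (p * q) => A; rewrite pevM pE qE.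
Qed.

Lemma polyfun_pev p : polyfun (pev p).
Proof.
apply: (polyfun_ext
  (f := fun A : M => \sum_(m <- msupp p) p@_m * \prod_k mxvec A 0 k ^+ m k)).
  by move=> A; rewrite /pev mevalE.
apply: polyfun_sum => m _; apply: pf_mul; first exact: pf_const.
apply: polyfun_prod => k _; apply: polyfun_exp.
case/mxvec_indexP: k => i j.
by apply: polyfun_ext (pf_coord L i j) => A; rewrite mxvecE.
Qed.

Lemma pev_comp p F : polymx F -> exists q, forall A, pev q A = pev p (F A).
Proof. by move=> pF; apply: polyfun_mpoly; apply: polyfun_comp pF; apply: polyfun_pev. Qed.

End PolynomialFunctions.

(** For nonempty [S] this says that the vanishing ideal is prime, that is, the Zariski closure of
    [S] is an irreducible variety. *)
Definition zirreducible (L : closedFieldType) n (S : 'M[L]_n -> Prop) :=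
  forall f g : 'M[L]_n -> L, polyfun f -> polyfun g ->
  (forall A, S A -> f A * g A = 0) ->
  (forall A, S A -> f A = 0) \/ (forall A, S A -> g A = 0).

(** * Connected groups are irreducible varieties *)

Section Irreducibility.
Variables (L : closedFieldType) (n : nat) (G : 'M[L]_n -> Prop).
Hypotheses (sG : subgroup G) (cG : zconnected G).
Local Notation R := {mpoly L[n * n]}.
Implicit Types p q s : R.

Definition vanish p := forall A, G A -> pev p A = 0.

Lemma vanish_ideal p : ideal (fun s => vanish (s * p)).
Proof.
split=> [A _|s t vs vt A GA|a s vs A GA].
- by rewrite mul0r pev0.
- by rewrite mulrDl pevD vs // vt // addr0.
- by rewrite -mulrA pevM vs // mulr0.
Qed.

(* Such an annihilator is the ideal of an irreducible component of G. *)
Lemma maximal_annihilator : exists p, ~ vanish p /\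
  forall a, ~ vanish (p * a) -> forall b, vanish (b * (p * a)) -> vanish (b * p).
Proof.
apply: NNPP => none.
(* If the claim fails, every nonvanishing [p] has a nonvanishing multiple with a strictly larger
   annihilator; iterating gives a strictly ascending chain of ideals. *)
have step (u : {p | ~ vanish p}) : exists v : {p | ~ vanish p},
    (exists a, sval v = sval u * a) /\
    exists b, vanish (b * sval v) /\ ~ vanish (b * sval u).
  case: u => p np /=; apply: NNPP => no; apply: none; exists p; split=> // a na b vb.
  apply: NNPP => nb; apply: no; exists (exist _ (p * a) na) => /=.
  by split; [exists a | exists b].
pose next u := sval (constructive_indefinite_description _ (step u)).
have nextP u := svalP (constructive_indefinite_description _ (step u)).
have n1 : ~ vanish 1.
  have [G1 _ _] := sG; move/(_ _ G1)/eqP; rewrite pev1; exact/negP/oner_neq0.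
pose c k := iter k next (exist _ 1 n1).
have [k p vp|K KP] :=
    @ascending_chain _ _ (fun k s => vanish (s * sval (c k))) (fun k => vanish_ideal _).
  have [[a ->] _] := nextP (c k); rewrite mulrA => A GA.
  by rewrite pevM vp // mul0r.
have [_ [b [vb]]] := nextP (c K); apply.
exact: (KP K.+1).
Qed.

(* The local ring of G at h is a domain. *)
Definition locally_integral h := forall p q, vanish (p * q) ->
  exists s, pev s h != 0 /\ (vanish (s * p) \/ vanish (s * q)).

(** At a point where the [p0] of [maximal_annihilator] is nonzero, [p0] itself serves as [s]: if
    [p0 * p] does not vanish on [G], then [q] kills it, and by maximality [q] kills [p0].
    Translations of [G] carry this to every point. *)
Lemma locally_integral_group h : G h -> locally_integral h.
Proof.
have [G1 GM GV] := sG => Gh.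
have [p0 [np0 maxp0]] := maximal_annihilator.
have [h0 [Gh0 ph0]] : exists h0, G h0 /\ pev p0 h0 != 0.
  apply: NNPP => no; apply: np0 => A GA; apply/eqP; apply: contra_notT no => nz.
  by exists A.
have loc0 : locally_integral h0.
  move=> p q vpq; exists p0; split=> //.
  case: (classic (vanish (p0 * p))) => [|np]; [by left|right].
  rewrite mulrC; apply: (maxp0 p np) => A GA.
  by rewrite [q * _]mulrCA [q * p]mulrC pevM vpq ?mulr0.
have [uh Gh'] := GV _ Gh; have [uh0 Gh0'] := GV _ Gh0.
move=> p q vpq.
pose k := h *m invmx h0; pose k' := h0 *m invmx h.
have Gk : G k by apply: GM.
have Gk' : G k' by apply: GM.
have kk' : k *m k' = 1%:M by rewrite /k /k' mulmxA mulmxKV // mulmxV.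
have tr (r : R) (m : 'M[L]_n) : exists r', forall A, pev r' A = pev r (m *m A).
  by apply: pev_comp; apply: polymx_mul; [apply: polymx_const | apply: polymx_id].
have [p' p'E] := tr p k; have [q' q'E] := tr q k.
have [|s [sh0 vs]] := loc0 p' q'.
  by move=> A GA; rewrite pevM p'E q'E -pevM vpq //; apply: GM.
have [s' s'E] := tr s k'; exists s'; split; first by rewrite s'E mulmxKV.
have kK A : k *m (k' *m A) = A by rewrite mulmxA kk' mul1mx.
case: vs => vs; [left|right] => A GA.
  by rewrite pevM s'E -[A in pev p A]kK -p'E -pevM vs //; apply: GM.
by rewrite pevM s'E -[A in pev q A]kK -q'E -pevM vs //; apply: GM.
Qed.

Lemma zclosed_locus (P : R -> Prop) : zclosed (fun A => forall s, P s -> pev s A = 0).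
Proof.
exists (fun f => exists s, P s /\ f = pev s); split=> [_ [s [_ ->]]|A].
  exact: polyfun_pev.
by split=> [H _ [s [Ps ->]]|H s Ps]; [apply: H | apply: H; exists s].
Qed.

(** Connectedness passes from the local rings to the whole of [G]: one of two disjoint closed loci
    must be everything, which makes [q] or [p] vanish. *)
Lemma vanish_prime p q : vanish (p * q) -> vanish p \/ vanish q.
Proof.
move=> vpq.
pose Ann s := vanish (s * p).
(* Since G is locally integral, the zero sets of Ann p and of its annihilator partition G. *)
pose Bnn t := forall s, Ann s -> vanish (t * s).
have cover A : G A -> (forall s, Ann s -> pev s A = 0) \/ (forall t, Bnn t -> pev t A = 0).
  move=> GA; case: (classic (forall s, Ann s -> pev s A = 0)) => [|no]; [by left|right].
  move=> t Bt; apply/eqP; apply: contra_notT no => tA s As.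
  by apply/eqP; have /eqP := Bt s As A GA; rewrite pevM mulf_eq0 (negPf tA).
(* At a common zero [A], local integrality kills each [s] in [Ann] by some [t] with [t A != 0]; the
   alternative puts [t] in [Ann], where it vanishes at [A]. The product of the [t] over finitely
   many generators of [Ann] lies in [Bnn] and is nonzero at [A]. *)
have disj A : ~ (G A /\ (forall s, Ann s -> pev s A = 0) /\ (forall t, Bnn t -> pev t A = 0)).
  move=> [GA [vA vB]].
  have locz s : Ann s -> exists t, pev t A != 0 /\ vanish (t * s).
    move=> As; have [t [tA [vt|vt]]] := locally_integral_group GA As; first by exists t.
    by move: tA; rewrite (vA t vt) eqxx.
  have [l [lA lgen]] := hilbert_basis (vanish_ideal p).
  have [t [tA vt]] : exists t, pev t A != 0 /\ forall s, s \in l -> vanish (t * s).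
    elim: l lA {lgen} => [|s l IH] lA; first by exists 1; rewrite pev1 oner_neq0.
    have [s' s'l|t [tA vt]] := IH; first by apply: lA; rewrite inE s'l orbT.
    have [t' [t'A vt']] := locz s (lA s (mem_head _ _)).
    exists (t * t'); split=> [|r]; first by rewrite pevM mulf_neq0.
    rewrite inE => /orP[/eqP->|rl] B GB.
      by rewrite -mulrA pevM vt' // mulr0.
    by rewrite mulrAC pevM vt // mul0r.
  move/eqP: tA; apply; apply: vB => s As; rewrite mulrC; move: s As.
  apply: lgen; first exact: vanish_ideal.
  by move=> s sl; rewrite mulrC; apply: vt.
have := cG (zclosed_locus Ann) (zclosed_locus Bnn) cover disj.
case=> [all0|all0]; [right|left] => A GA.
  by apply: all0 => //; rewrite /Ann mulrC.
case: (classic (exists s, Ann s /\ pev s A != 0)) => [[s [As sA]]|no].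
  by apply/eqP; have /eqP := As A GA; rewrite pevM mulf_eq0 (negPf sA).
case: (disj A); split=> //; split; last exact: all0.
by move=> s As; apply/eqP; apply: contra_notT no => sA; exists s.
Qed.

Lemma zconnected_irreducible : zirreducible G.
Proof.
move=> f g /polyfun_mpoly[p pE] /polyfun_mpoly[q qE] fg.
have [|v|v] := @vanish_prime p q.
- by move=> A GA; rewrite pevM pE qE fg.
- by left=> A GA; rewrite -pE v.
- by right=> A GA; rewrite -qE v.
Qed.

End Irreducibility.

(** * Derivatives *)

Section LinearAlgebra.

(** Enlarge a matrix whose rows lie in [W] by one vector at a time; the rank cannot exceed [m], so
    at some stage all of [W] is reached. *)
Lemma subspace_mx (F : fieldType) m (W : 'rV[F]_m -> Prop) :
  W 0 -> (forall a u v, W u -> W v -> W (a *: u + v)) ->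
  exists B : 'M[F]_m, forall v, W v <-> (v <= B)%MS.
Proof.
move=> W0 Wlin.
have grow k : (exists B : 'M[F]_m, forall v, W v <-> (v <= B)%MS) \/
    exists B : 'M[F]_m, (k <= \rank B)%N /\ forall v, (v <= B)%MS -> W v.
  elim: k => [|k [|[B [rB BW]]]]; [|by left|].
    by right; exists 0; split=> // v; rewrite submx0 => /eqP->.
  case: (classic (forall v, W v -> (v <= B)%MS)) => [WB|noW].
    by left; exists B => v; split; [apply: WB | apply: BW].
  have [v [Wv vB]] : exists v, W v /\ ~~ (v <= B)%MS.
    apply: NNPP => no; apply: noW => v Wv; apply: contra_notT no => vB.
    by exists v.
  right; exists (B + v)%MS; split.
    apply: leq_ltn_trans rB _; apply: rank_ltmx.
    rewrite ltmxE addsmxSl /=; apply: contra vB; apply: submx_trans.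
    exact: addsmxSr.
  move=> u /sub_addsmxP[[u1 u2] ->] /=; rewrite addrC.
  rewrite [u2]mx11_scalar mul_scalar_mx; apply: Wlin => //.
  by apply: BW; apply: submxMl.
case: (grow m.+1) => // -[B [rB _]].
by have := leq_trans rB (rank_leq_row B); rewrite ltnn.
Qed.

Lemma poly_horner_inj (L : closedFieldType) (p q : {poly L}) :
  (forall t, p.[t] = q.[t]) -> p = q.
Proof.
move=> pq; apply/eqP; rewrite -subr_eq0; apply: contraT => /closed_nonrootP[x].
by rewrite rootE !hornerE pq subrr eqxx.
Qed.

Lemma invmx_det1 (F : fieldType) n (A : 'M[F]_n) : \det A = 1 -> invmx A = \adj A.
Proof. by move=> dA; rewrite /invmx unitmxE dA unitr1 invr1 scale1r. Qed.

End LinearAlgebra.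

Section Derivatives.
Variables (L : closedFieldType).

Lemma mpoly_ring_ind N (P : {mpoly L[N]} -> Prop) :
  (forall c, P c%:MP) -> (forall i, P 'X_i) ->
  (forall p q, P p -> P q -> P (p + q)) -> (forall p q, P p -> P q -> P (p * q)) ->
  forall p, P p.
Proof.
move=> PC PX PD PM p; rewrite [p]mpolyE.
apply: (big_ind P) => // [|m _]; first by rewrite -mpolyC0.
rewrite -mul_mpolyC; apply: (PM) => //; rewrite mpolyXE_id.
apply: (big_ind P) => // [|i _]; first by rewrite -mpolyC1.
elim: (m i) => [|k IH]; first by rewrite expr0 -mpolyC1.
by rewrite exprS; apply: PM.
Qed.

Lemma mderivXU N (i k : 'I_N) : ('X_i : {mpoly L[N]})^`M(k) = (i == k)%:R.
Proof.
rewrite mderivX mnm1E; case: eqVneq => [->|_]; last by rewrite scale0r.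
by rewrite scale1r -{1}[U_(k)%MM]add0m addmK mpolyX0.
Qed.

(** Keeping the quotients [q k] instead of a quadratic remainder turns equations on [G] into linear
    systems in the ['X_k - v k]. By induction on [p]; only the values of the [q k] at [v] are
    prescribed. *)
Lemma taylor1 N (v : 'I_N -> L) (p : {mpoly L[N]}) :
  exists q : 'I_N -> {mpoly L[N]},
    p = p.@[v]%:MP + \sum_k ('X_k - (v k)%:MP) * q k /\
    forall k, (q k).@[v] = p^`M(k).@[v].
Proof.
elim/mpoly_ring_ind: p => [c|i|p p' [q [pE qE]] [q' [pE' qE']]|p p' [q [pE qE]] [q' [pE' qE']]].
- exists (fun=> 0); split=> [|k]; last by rewrite mderivC.
  by rewrite mevalC big1 ?addr0 // => k _; rewrite mulr0.
- exists (fun k => (i == k)%:R); split=> [|k]; last by rewrite mderivXU.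
  rewrite mevalXU (bigD1 i) //= big1 => [|k ki]; last by rewrite eq_sym (negPf ki) mulr0.
  by rewrite eqxx mulr1 addr0 addrC subrK.
- exists (fun k => q k + q' k); split=> [|k]; last by rewrite mderivD !mevalD qE qE'.
  rewrite {1}pE {1}pE' mevalD mpolyCD addrACA -big_split /=.
  by congr (_ + _); apply: eq_bigr => k _; rewrite mulrDr.
- exists (fun k => p.@[v]%:MP * q' k + q k * p'); split=> [|k]; last first.
    by rewrite mderivM !mevalD !mevalM mevalC qE qE' addrC.
  rewrite {1}pE mulrDl {1}pE' mulrDr mevalM mpolyCM -addrA; congr (_ + _).
  rewrite mulr_sumr mulr_suml -big_split /=; apply: eq_bigr => k _.
  by rewrite mulrDr mulrCA !mulrA.
Qed.

Variable n : nat.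
Local Notation M := 'M[L]_n.
Implicit Types (p q : {mpoly L[n * n]}) (A X : M).

Definition dd p A X : L := \sum_k pev p^`M(k) A * mxvec X 0 k.

Lemma ddD p q A X : dd (p + q) A X = dd p A X + dd q A X.
Proof. by rewrite /dd -big_split; apply: eq_bigr => k _; rewrite mderivD pevD mulrDl. Qed.

Lemma ddM p q A X : dd (p * q) A X = dd p A X * pev q A + pev p A * dd q A X.
Proof.
rewrite /dd mulr_sumr mulr_suml -big_split; apply: eq_bigr => k _ /=.
by rewrite mderivM pevD !pevM mulrDl mulrA (mulrAC (pev _^`M(k) A)).
Qed.

Lemma dd_lin p A a X Y : dd p A (a *: X + Y) = a * dd p A X + dd p A Y.
Proof.
rewrite /dd mulr_sumr -big_split; apply: eq_bigr => k _ /=.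
by rewrite linearP !mxE mulrDr mulrCA.
Qed.

Lemma ddE p A X :
  dd p A X = \sum_i \sum_j pev p^`M(mxvec_index i j) A * X i j.
Proof.
rewrite /dd (reindex _ (curry_mxvec_bij _ _)) /= pair_bigA /=.
by apply: eq_bigr => -[i j] _ /=; rewrite mxvecE.
Qed.

Lemma dd_delta p A i j : dd p A (delta_mx i j) = pev p^`M(mxvec_index i j) A.
Proof.
rewrite ddE (bigD1 i) //= (bigD1 j) //= mxE !eqxx mulr1 !big1 ?addr0 //.
  by move=> k ki; rewrite big1 // => l _; rewrite mxE (negPf ki) mulr0.
by move=> l lj; rewrite mxE (negPf lj) andbF mulr0.
Qed.

(** On a line, [dd] is the coefficient of [t], so identities between differentials reduce to
    identities of polynomials in one variable. *)
Lemma pev_line p A X : exists q : {poly L},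
  (forall t, pev p (A + t *: X) = q.[t]) /\ q`_1 = dd p A X.
Proof.
elim/mpoly_ring_ind: p => [c|k|p p' [q [pE qE]] [q' [pE' qE']]|p p' [q [pE qE]] [q' [pE' qE']]].
- exists c%:P; split=> [t|]; first by rewrite pevC hornerC.
  by rewrite coefC /dd big1 // => k _; rewrite mderivC pev0 mul0r.
- exists ((mxvec A 0 k)%:P + (mxvec X 0 k) *: 'X); split=> [t|].
    by rewrite /pev mevalXU linearD linearZ !mxE !hornerE mulrC.
  rewrite coefD coefC coefZ coefX mulr1 add0r /dd (bigD1 k) //= big1 => [|l lk].
    by rewrite mderivXU eqxx pev1 mul1r addr0.
  by rewrite mderivXU eq_sym (negPf lk) pev0 mul0r.
- exists (q + q'); split=> [t|]; first by rewrite pevD pE pE' hornerD.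
  by rewrite coefD qE qE' ddD.
- exists (q * q'); split=> [t|]; first by rewrite pevM pE pE' hornerM.
  have e0 (r : {mpoly L[n * n]}) s : (forall t, pev r (A + t *: X) = s.[t]) -> s`_0 = pev r A.
    by move=> /(_ 0); rewrite scale0r addr0 horner_coef0.
  rewrite coefM !big_ord_recl big_ord0 /= qE qE' (e0 _ _ pE) (e0 _ _ pE') ddM.
  by rewrite addr0 addrC mulrC [X in _ + X]mulrC; congr (_ + _); rewrite mulrC.
Qed.

Lemma dd_comp_linear p q (F : M -> M) A X : (forall B, pev q B = pev p (F B)) ->
  (forall t, F (A + t *: X) = F A + t *: F X) -> dd q A X = dd p (F A) (F X).
Proof.
move=> qp Flin; have [r [rE <-]] := pev_line q A X.
have [s [sE <-]] := pev_line p (F A) (F X).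
suff -> : r = s by [].
by apply: poly_horner_inj => t; rewrite -rE qp Flin sE.
Qed.

End Derivatives.

(** * The tangent space at 1 *)

Lemma mxtrace_mul_delta (F : fieldType) n (Y : 'M[F]_n) i j :
  \tr (Y *m delta_mx j i) = Y i j.
Proof.
rewrite /mxtrace (bigD1 i) //= mxE (bigD1 j) //= mxE !eqxx mulr1 !big1 ?addr0 //.
  by move=> k ki; rewrite mxE big1 // => l _; rewrite mxE (negPf ki) andbF mulr0.
by move=> l lj; rewrite mxE (negPf lj) mulr0.
Qed.

Section Group.
Variables (L : closedFieldType) (n : nat) (G : 'M[L]_n -> Prop).
Hypothesis sG : subgroup G.
Hypothesis G_det : forall A, G A -> \det A = 1.
Hypothesis G_dom : zirreducible G.
Hypothesis G_irr : taut_irreducible G.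
Local Notation M := 'M[L]_n.
Implicit Types (p q : {mpoly L[n * n]}) (A X h : M).

Let G1 : G 1%:M. Proof. by case: sG. Qed.
Let GM A B : G A -> G B -> G (A *m B). Proof. by case: sG => _ + _; apply. Qed.
Let GV A : G A -> G (invmx A). Proof. by case: sG => _ _ H /H[]. Qed.
Let Gu A : G A -> A \in unitmx. Proof. by case: sG => _ _ H /H[]. Qed.
Let GVadj A : G A -> invmx A = \adj A.
Proof. by move=> /G_det; apply: invmx_det1. Qed.

(** The vectors whose [G]-translates all have zero [i]-th coordinate form an invariant subspace. It
    does not contain the [i]-th basis vector, so it is 0; if the entry vanished on [G], it would
    contain the [j]-th one. *)
Lemma entry_neq0 i j : exists h, G h /\ h i j != 0.
Proof.
apply: NNPP => no.
have h0 h : G h -> h i j = 0.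
  by move=> Gh; apply/eqP; apply: contra_notT no => nz; exists h.
pose W (v : 'rV[L]_n) := forall h, G h -> (v *m h^T) 0 i = 0.
have [||B BW] := @subspace_mx L n W.
- by move=> h _; rewrite mul0mx mxE.
- move=> a u v Wu Wv h Gh.
  by rewrite mulmxDl -scalemxAl !mxE; have := Wu h Gh; have := Wv h Gh;
     rewrite !mxE => -> ->; rewrite mulr0 addr0.
have [g Gg|B0|Bfull] := G_irr (U := B).
- apply/row_subP => k; rewrite row_mul; apply/BW => h Gh.
  rewrite -mulmxA -trmx_mul; have /BW Wk := row_sub k B.
  by apply: Wk; apply: GM.
- have /BW : W (delta_mx 0 j).
    by move=> h Gh; rewrite -rowE !mxE h0.
  rewrite B0 submx0 => /eqP/matrixP/(_ 0 j); rewrite !mxE !eqxx => /eqP.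
  by rewrite oner_eq0.
have /BW/(_ _ G1) : ((delta_mx 0 i : 'rV[L]_n) <= B)%MS by apply: submx_full.
by rewrite trmx1 mulmx1 mxE !eqxx => /eqP; rewrite oner_eq0.
Qed.

(** Comparing the entries [(k, j)] of [h X = (h X h^-1) h], with both [X] and its conjugate
    diagonal, gives [h k j * (X j j - D k h) = 0] on [G]. As [h k j] is not identically zero,
    irreducibility gives [X j j = D k h] for all [j]. In [D], [\adj h] replaces the inverse to keep
    it polynomial. *)
Lemma conj_diag_scalar (k0 : 'I_n) X :
  (forall h, G h -> is_diag_mx (h *m X *m invmx h)) -> exists c, X = c%:M.
Proof.
move=> dg.
have Xd i j : i != j -> X i j = 0.
  by have /is_diag_mxP := dg _ G1; rewrite mul1mx invmx1 mulmx1; apply.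
pose D k h := (h *m X *m \adj h) k k.
have pD k : polyfun (D k).
  apply: polymx_mul; last exact: polymx_adj.
  by apply: polymx_mul; [apply: polymx_id | apply: polymx_const].
have XD k j h : G h -> X j j = D k h.
  move=> Gh; apply/eqP; rewrite -subr_eq0; apply/eqP; move: h Gh.
  have [|||v|//] := @G_dom (fun h => h k j) (fun h => X j j - D k h).
  - exact: pf_coord.
  - by apply: polyfun_sub; [apply: pf_const | apply: pD].
  - move=> h Gh; apply/eqP; rewrite mulrBr subr_eq0 mulrC [eqbRHS]mulrC; apply/eqP.
    have /is_diag_mxP dh := dg h Gh.
    have := congr1 (fun Y : M => Y k j) (mulmxKV (Gu Gh) (h *m X)).
    rewrite mxE (bigD1 k) //= big1 ?addr0 => [|l lk]; last first.
      by rewrite dh ?mul0r // eq_sym.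
    rewrite GVadj // => ->; rewrite mxE (bigD1 j) //= big1 ?addr0 1?mulrC //.
    by move=> l lj; rewrite Xd ?mulr0.
  - have [h [Gh hkj]] := entry_neq0 k j.
    by rewrite v ?eqxx in hkj.
exists (X k0 k0); apply/matrixP => i j; rewrite mxE.
case: eqVneq => [<-|/Xd->//]; rewrite mulr1n.
by rewrite (XD i i _ G1) -(XD i k0 _ G1).
Qed.

Definition tangent h X := forall p, vanish G p -> dd p h X = 0.

Lemma tangent_lin h a X Y : tangent h X -> tangent h Y -> tangent h (a *: X + Y).
Proof. by move=> tX tY p vp; rewrite dd_lin tX // tY // mulr0 addr0. Qed.

Lemma tangent0 h : tangent h 0.
Proof.
by move=> p _; rewrite ddE big1 // => i _; rewrite big1 // => j _; rewrite mxE mulr0.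
Qed.

Lemma tangentZ h a X : tangent h X -> tangent h (a *: X).
Proof. by move=> tX; rewrite -[_ *: _]addr0; apply: tangent_lin => //; apply: tangent0. Qed.

Lemma tangent_sum (I : Type) (r : seq I) (P : pred I) h (F : I -> M) :
  (forall i, P i -> tangent h (F i)) -> tangent h (\sum_(i <- r | P i) F i).
Proof.
move=> tF; apply: (big_ind (tangent h)) => //; first exact: tangent0.
by move=> X Y tX tY; rewrite -[X]scale1r; apply: tangent_lin.
Qed.

(** The linear map [F] preserves [G], so composition with it preserves the vanishing polynomials,
    and the chain rule applies. *)
Lemma tangent_translate A B h X : G A -> G B ->
  tangent h X -> tangent (A *m h *m B) (A *m X *m B).
Proof.
move=> GA GB tX p vp; pose F (Y : M) := A *m Y *m B.
have pF : polymx F.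
  apply: polymx_mul; last exact: polymx_const.
  by apply: polymx_mul; [apply: polymx_const | apply: polymx_id].
have [q qE] := pev_comp p pF.
rewrite -(dd_comp_linear (F := F) (q := q)) // => [|t]; last first.
  by rewrite /F mulmxDr mulmxDl -scalemxAr -scalemxAl.
by apply: tX => C GC; rewrite qE vp //; apply: GM => //; apply: GM.
Qed.

Lemma tangent1_translate h X : G h -> tangent h X <-> tangent 1%:M (invmx h *m X).
Proof.
move=> Gh; split=> t.
  have := tangent_translate (GV Gh) G1 t.
  by rewrite !mulmx1 mulVmx // Gu.
have := tangent_translate Gh G1 t.
by rewrite !mulmx1 mulKVmx // Gu.
Qed.

Lemma tangent_conj h X : G h -> tangent 1%:M X -> tangent 1%:M (h *m X *m invmx h).
Proof.
move=> Gh /(tangent_translate Gh (GV Gh)); rewrite mulmx1 mulmxV //; exact: Gu.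
Qed.

(** * Weights of a diagonal element on the tangent space *)

Variable d : 'rV[L]_n.
Hypothesis Gd : G (diag_mx d).
Hypothesis d_inj : forall i j, i != j -> d 0 i != d 0 j.
Hypothesis d_ratio : forall i j k l, i != j -> k != l -> (i, j) != (k, l) ->
  d 0 i * d 0 l != d 0 k * d 0 j.

Lemma d_neq0 i : d 0 i != 0.
Proof.
have := oner_neq0 L; rewrite -(G_det Gd) det_diag; apply: contra => /eqP di.
by rewrite (bigD1 i) //= di mul0r.
Qed.

(** The ratios are the eigenvalues of Ad([diag_mx d]) on matrix units: for [k != l] the one of
    [E_kl] is attained at no other unit, diagonal ones (eigenvalue 1) included. *)
Lemma d_ratio_neq k l i j : k != l -> (i, j) != (k, l) ->
  d 0 i / d 0 j != d 0 k / d 0 l.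
Proof.
move=> kl ijkl; rewrite eqr_div ?d_neq0 //.
case: (eqVneq i j) => [<-|ij]; last exact: d_ratio.
by rewrite mulrC (inj_eq (mulIf (d_neq0 i))) d_inj // eq_sym.
Qed.

(** The tangent space is stable under polynomials in Ad([diag_mx d]), and one of these projects onto
    the simple eigenspace spanned by [delta_mx k l]. *)
Lemma tangent_weight X k l : tangent 1%:M X -> k != l -> X k l != 0 ->
  tangent 1%:M (delta_mx k l).
Proof.
move=> tX kl Xkl.
have tpow m : tangent 1%:M (\matrix_(i, j) ((d 0 i / d 0 j) ^+ m * X i j)).
  elim: m => [|m IH].
    by move: tX; congr (tangent _ _); apply/matrixP => i j; rewrite mxE expr0 mul1r.
  have := tangent_conj Gd IH; congr (tangent _ _); apply/matrixP => i j.
  have -> : invmx (diag_mx d) = diag_mx (\row_j (d 0 j)^-1).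
    apply: (can_inj (mulKmx (Gu Gd))); rewrite mulmxV ?Gu // mulmx_diag.
    apply/matrixP => a b; rewrite !mxE divff ?d_neq0 //.
  by rewrite mul_mx_diag mul_diag_mx !mxE exprS !mulrA mulrAC; congr (_ * _); rewrite mulrAC.
have tpol (q : {poly L}) : tangent 1%:M (\matrix_(i, j) (q.[d 0 i / d 0 j] * X i j)).
  have -> : \matrix_(i, j) (q.[d 0 i / d 0 j] * X i j) =
      \sum_(m < size q) q`_m *: \matrix_(i, j) ((d 0 i / d 0 j) ^+ m * X i j).
    apply/matrixP => i j; rewrite mxE horner_coef mulr_suml summxE.
    by apply: eq_bigr => m _; rewrite !mxE mulrA.
  by apply: tangent_sum => m _; apply: tangentZ.
(* Evaluated at Ad(diag d), q kills every weight other than (k, l). *)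
pose q := \prod_(ij : 'I_n * 'I_n | ij != (k, l)) ('X - (d 0 ij.1 / d 0 ij.2)%:P).
have qkl : q.[d 0 k / d 0 l] != 0.
  rewrite horner_prod; apply/prodf_neq0 => -[i j] ijkl.
  by rewrite !hornerE subr_eq0 eq_sym d_ratio_neq.
have := tangentZ (q.[d 0 k / d 0 l] * X k l)^-1 (tpol q).
congr (tangent _ _); apply/matrixP => i j; rewrite !mxE.
case: (eqVneq (i, j) (k, l)) => [[-> ->]|ijkl].
  by rewrite !eqxx mulVf // mulf_neq0.
have -> : (i == k) && (j == l) = false by apply: contraNF ijkl => /andP[/eqP-> /eqP->].
suff -> : q.[d 0 i / d 0 j] = 0 by rewrite !(mul0r, mulr0).
by rewrite horner_prod (bigD1 (i, j)) //= hornerXsubC subrr mul0r.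
Qed.

(** The entry [(i, j)] of the conjugate of [delta_mx k l] by [h] is [h i k * \adj h l j]. By
    irreducibility some [h] makes both factors nonzero, and then [tangent_weight] extracts
    [delta_mx i j]. *)
Lemma tangent_delta_all X k l : tangent 1%:M X -> k != l -> X k l != 0 ->
  forall i j, i != j -> tangent 1%:M (delta_mx i j).
Proof.
move=> tX kl Xkl i j ij; have tkl := tangent_weight tX kl Xkl.
have [h [Gh hik hlj]] : exists h, [/\ G h, h i k != 0 & \adj h l j != 0].
  apply: NNPP => no.
  have [||h Gh|v|v] := @G_dom (fun h => h i k) (fun h => \adj h l j).
  - exact: pf_coord.
  - exact: polymx_adj.
  - apply/eqP; apply: contra_notT no; rewrite mulf_eq0 negb_or => /andP[? ?].
    by exists h.
  - by have [h [Gh]] := entry_neq0 i k; rewrite v ?eqxx.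
  (* [h] is the adjugate of its inverse, which lies in [G] too. *)
  have [h [Gh]] := entry_neq0 l j.
  by rewrite -[h]invmxK GVadj ?v ?eqxx //; apply: GV.
apply: (tangent_weight (tangent_conj Gh tkl)) => //.
rewrite GVadj // -(mul_delta_mx (0 : 'I_1)) mulmxA -colE -mulmxA -rowE.
by rewrite mxE big_ord1 !mxE mulf_neq0 //; move: hlj; rewrite mxE.
Qed.

(** Each differential at 1 of a vanishing polynomial is a trace form [Y |-> \tr (Z *m Y)]. It kills
    all conjugates of the off-diagonal units, so all conjugates of [Z] are diagonal and [Z] is
    scalar. *)
Lemma tangent_sl (k l : 'I_n) X : k != l -> 
  (forall i j : 'I_n, i != j -> tangent 1%:M (delta_mx i j)) ->
  \tr X = 0 -> tangent 1%:M X.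
Proof.
move=> kl tall trX p vp.
pose Z : M := \matrix_(i, j) pev p^`M(mxvec_index j i) 1%:M.
have ZE Y : dd p 1%:M Y = \tr (Z *m Y).
  rewrite ddE /mxtrace exchange_big /=; apply: eq_bigr => j _.
  by rewrite mxE; apply: eq_bigr => i _; rewrite mxE.
have [h Gh|c Zc] := conj_diag_scalar k (X := Z); last first.
  by rewrite ZE Zc mul_scalar_mx mxtraceZ trX mulr0.
apply/is_diag_mxP => i j ij.
have := tangent_conj (GV Gh) (tall j i _) vp; rewrite eq_sym => /(_ ij).
by rewrite ZE invmxK !mulmxA mxtrace_mulC !mulmxA mxtrace_mul_delta.
Qed.

End Group.

(** * Isolated zeros *)

Lemma pevX1 (L : closedFieldType) n k (h : 'M[L]_n) : pev 'X_k h = mxvec h 0 k.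
Proof. exact: mevalXU. Qed.

Section IsolatedZeros.
Variables (L : closedFieldType) (n : nat) (G : 'M[L]_n -> Prop).
Hypothesis G_dom : zirreducible G.
Local Notation M := 'M[L]_n.
Local Notation R := {mpoly L[n * n]}.
Implicit Types (p q : R) (A X h : M).

Variables (g : M) (k0 : 'I_(n * n)).
Hypothesis Gg : G g.
Let v k := mxvec g 0 k.
Hypothesis vk0 : v k0 != 0.
Hypothesis g_tan : forall X, tangent G g X -> exists c, X = c *: g.

(** Double annihilator: the tangent space is the annihilator of the space [W] of differentials at
    [g] and lies on the line through [g], so [W] contains everything orthogonal to [g]. *)
Lemma conormal_vector (c : 'rV[L]_(n * n)) : \sum_k c 0 k * v k = 0 ->
  exists p, vanish G p /\ forall k, pev p^`M(k) g = c 0 k.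
Proof.
move=> cv.
pose W (u : 'rV[L]_(n * n)) := exists p, vanish G p /\ forall k, pev p^`M(k) g = u 0 k.
have [||B BW] := @subspace_mx L _ W.
- by exists 0; split=> [A _|k]; rewrite ?mderiv0 pev0 ?mxE.
- move=> a u w [p [vp pu]] [q [vq qw]]; exists (a%:MP * p + q); split=> [A GA|k].
    by rewrite pevD pevM vp // vq // mulr0 addr0.
  by rewrite mderivD mderiv_mulC pevD pevM pevC pu qw !mxE.
have [C CW] : exists C : 'M_(n * n), forall v, W v <-> v *m C = 0.
  by exists (cokermx B) => u; rewrite BW submxE; split=> [/eqP|->].
suff /CW : c *m C = 0 by [].
apply/matrixP => i j; rewrite mxE [RHS]mxE {i}(ord1 i).
(* The columns of [C] span the annihilator of [W], so each of them is a tangent vector at [g]. *)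
pose x k := C k j.
have [p vp|a Xa] := g_tan (X := vec_mx (\row_k x k)).
  have /CW : W (\row_k pev p^`M(k) g) by exists p; split=> // k; rewrite mxE.
  move/matrixP/(_ 0 j); rewrite mxE [RHS]mxE => <-.
  by rewrite /dd vec_mxK; apply: eq_bigr => k _; rewrite !mxE.
have xk k : x k = a * v k.
  by have := congr1 (fun Y => mxvec Y 0 k) Xa; rewrite vec_mxK linearZ !mxE.
rewrite (eq_bigr (fun k => a * (c 0 k * v k))) => [|k _].
  by rewrite -mulr_sumr cv mulr0.
by rewrite -/(x k) xk mulrCA.
Qed.

(* Nakayama: a tangent space spanned by g makes the maximal ideal at g locally principal. *)
Lemma locally_principal : exists s (b : 'I_(n * n) -> R), pev s g = 1 /\
  forall k h, G h ->
    pev s h * (mxvec h 0 k - v k) = (mxvec h 0 k0 - v k0) * pev (b k) h.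
Proof.
(* The covector [e_i - (v i / v k0) e_k0] is orthogonal to [v], hence is the differential at [g] of
   some [p i] vanishing on [G]. *)
pose cv i : 'rV[L]_(n * n) := \row_k ((i == k)%:R - v i / v k0 * (k == k0)%:R).
have cP i : \sum_k cv i 0 k * v k = 0.
  rewrite (eq_bigr (fun k => (i == k)%:R * v k - v i / v k0 * (k == k0)%:R * v k)).
    rewrite sumrB (bigD1 i) //= [X in _ - X](bigD1 k0) //= !eqxx !big1.
    - by rewrite !addr0 mul1r mulr1 divfK // subrr.
    - by move=> k /negPf->; rewrite mulr0 mul0r.
    - by move=> k; rewrite eq_sym => /negPf->; rewrite mul0r.
  by move=> k _; rewrite mxE mulrBl.
have [p pP] : exists p : 'I_(n * n) -> R, forall i, vanish G (p i) /\
    forall k, pev (p i)^`M(k) g = cv i 0 k.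
  have H i := conormal_vector (cP i).
  exists (fun i => sval (constructive_indefinite_description _ (H i))) => i.
  exact: svalP (constructive_indefinite_description _ (H i)).
have [q qP] : exists q : 'I_(n * n) -> 'I_(n * n) -> R, forall i,
    p i = (p i).@[v]%:MP + \sum_k ('X_k - (v k)%:MP) * q i k /\
    forall k, (q i k).@[v] = (p i)^`M(k).@[v].
  have H i := taylor1 v (p i).
  exists (fun i => sval (constructive_indefinite_description _ (H i))) => i.
  exact: svalP (constructive_indefinite_description _ (H i)).
(* The correction in column [k0] makes [A] the identity at [g]. On [G] the equations [p i = 0]
   become [A z = z_k0 *: (v / v k0)], where [z] lists the differences of coordinates from [g];
   multiplying by [\adj A] gives the claim with [s = \det A]. *)
pose A : 'M[R]_(n * n) := \matrix_(i, k) (q i k + (v i / v k0 * (k == k0)%:R)%:MP).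
exists (\det A), (fun i => \sum_k \adj A i k * (v k / v k0)%:MP); split.
  rewrite /pev -[LHS]det_map_mx -[RHS](det1 L (n * n)); congr (\det _).
  apply/matrixP => i k; rewrite !mxE -[LHS]/(pev _ g) pevD pevC.
  have -> : pev (q i k) g = cv i 0 k by rewrite -(proj2 (pP i)); apply: (proj2 (qP i)).
  by rewrite mxE subrK.
move=> i h Gh.
pose z : 'cV[L]_(n * n) := \col_k (mxvec h 0 k - v k).
pose Ah : 'M[L]_(n * n) := map_mx (meval (fun k => mxvec h 0 k)) A.
have Az : Ah *m z = (mxvec h 0 k0 - v k0) *: \col_k (v k / v k0).
  apply/colP => k; rewrite !mxE.
  rewrite (eq_bigr (fun l => pev (('X_l - (v l)%:MP) * q k l) h +
      (v k / v k0 * (l == k0)%:R) * (mxvec h 0 l - v l))) => [|l _]; last first.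
    by rewrite !mxE -[X in X * _]/(pev _ h) pevD pevM pevB pevX1 !pevC; ring.
  rewrite big_split /= -pev_sum.
  have -> : \sum_l ('X_l - (v l)%:MP) * q k l = p k.
    rewrite [RHS](proj1 (qP k)); have := proj1 (pP k) g Gg.
    by rewrite /pev => ->; rewrite mpolyC0 add0r.
  rewrite (proj1 (pP k)) // add0r (bigD1 k0) //= eqxx mulr1 big1 ?addr0 1?mulrC //.
  by move=> l /negPf->; rewrite mulr0 mul0r.
have := congr1 (fun u : 'cV_(n * n) => u i 0) (congr1 (mulmx (\adj Ah)) Az).
rewrite mulmxA mul_adj_mx mul_scalar_mx -scalemxAr !mxE.
rewrite /Ah det_map_mx => ->; congr (_ * _); rewrite pev_sum; apply: eq_bigr => k _.
by rewrite pevM pevC [RHS]mulrC mulrC -map_mx_adj !mxE.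
Qed.

(** On [G], up to powers of [s], [phi] is a power of the parameter [Y] times a factor nonzero at
    [g]. Where [s] and this factor are nonzero, a zero of [phi] is a zero of [Y], and
    [locally_principal] then forces all coordinates to agree with those of [g]. *)
Lemma isolated_zero phi : pev phi g = 0 -> ~ vanish G phi ->
  exists s, pev s g != 0 /\ forall h, G h -> pev s h != 0 -> pev phi h = 0 -> h = g.
Proof.
move=> phig nphi.
have [s [b [sg sP]]] := locally_principal.
pose Y : R := 'X_k0 - (v k0)%:MP.
have YE h : pev Y h = mxvec h 0 k0 - v k0 by rewrite /Y pevB pevX1 pevC.
have Yg : pev Y g = 0 by rewrite YE subrr.
have step u : exists w, pev u g = 0 ->
    forall h, G h -> pev s h * pev u h = pev Y h * pev w h.
  have [q [uE _]] := taylor1 v u; exists (\sum_k b k * q k) => ug h Gh.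
  have -> : u = \sum_k ('X_k - (v k)%:MP) * q k.
    by rewrite [LHS]uE -[u.@[v]]/(pev u g) ug mpolyC0 add0r.
  rewrite !pev_sum !mulr_sumr; apply: eq_bigr => k _.
  rewrite !pevM !mulrA YE -sP //; congr (_ * _ * _).
  by rewrite pevB pevX1 pevC.
pose next u := sval (constructive_indefinite_description _ (step u)).
have nextP u := svalP (constructive_indefinite_description _ (step u)).
(* Divide phi by the local parameter Y at g as long as the quotient vanishes at g; if this
   never stopped, the quotients c k would generate a strictly ascending chain of ideals of the
   local ring at g. *)
pose c k := iter k next phi.
have [k [ck_g ckE]] : exists k, pev (c k) g != 0 /\
    forall h, G h -> pev s h ^+ k * pev phi h = pev Y h ^+ k * pev (c k) h.
  apply: NNPP => none.
  have cP k : pev (c k) g = 0 /\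
      forall h, G h -> pev s h ^+ k * pev phi h = pev Y h ^+ k * pev (c k) h.
    elim: k => [|k [cg ckE]]; first by split=> // h _; rewrite !expr0.
    have ckE' h : G h -> pev s h ^+ k.+1 * pev phi h = pev Y h ^+ k.+1 * pev (c k.+1) h.
      move=> Gh; rewrite exprS -mulrA ckE // mulrCA (nextP (c k) cg) //.
      by rewrite mulrA exprSr.
    split=> //; apply/eqP; apply: contra_notT none => nz; by exists k.+1.
  (* The ideal generated by [c k] on [G] after inverting [s]. *)
  pose J k u := exists m a, forall h, G h -> pev s h ^+ m * pev u h = pev a h * pev (c k) h.
  have [k|k u [m [a ua]]|K KP] := @ascending_chain _ _ J.
  - split.
    + by exists 0%N, 0 => h _; rewrite !pev0 mulr0 mul0r.
    + move=> u w [m [a ua]] [m' [a' wa]]; exists (m + m')%N, (s ^+ m' * a + s ^+ m * a').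
      move=> h Gh; rewrite !pevD !pevM !pevX exprD.
      transitivity (pev s h ^+ m' * (pev s h ^+ m * pev u h) +
                    pev s h ^+ m * (pev s h ^+ m' * pev w h)); first by ring.
      by rewrite ua // wa //; ring.
    + move=> w u [m [a ua]]; exists m, (w * a) => h Gh.
      by rewrite !pevM mulrCA ua // mulrA.
  - exists m.+1, (a * Y) => h Gh; rewrite exprS -mulrA ua // mulrCA.
    by rewrite (nextP (c k) (proj1 (cP k))) // pevM mulrA.
  have [|m [a ma]] := KP K.+1 (c K.+1).
    by exists 0%N, 1 => h _; rewrite pev1 expr0.
  (* Since [s * c K = Y * c K.+1] on [G], stabilization gives [(s ^+ m.+1 - Y * a) * c K = 0], whose
     first factor is 1 at [g]. So [c K] vanishes on [G], and with it [phi]. *)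
  have [|||v1|v1] := @G_dom (pev (s ^+ m.+1 - Y * a)) (pev (c K)).
  - exact: polyfun_pev.
  - exact: polyfun_pev.
  - move=> h Gh; rewrite pevB pevX pevM mulrBl -[X in _ - X]mulrA -ma // mulrCA.
    rewrite -[pev Y h * _](nextP (c K) (proj1 (cP K))) // mulrA -exprSr subrr //.
  - have := v1 g Gg; rewrite pevB pevX pevM sg Yg expr1n mul0r subr0 => /eqP.
    by rewrite oner_eq0.
  have [|||v2|v2] := @G_dom (pev (s ^+ K)) (pev phi).
  - exact: polyfun_pev.
  - exact: polyfun_pev.
  - by move=> h Gh; rewrite pevX (proj2 (cP K)) // v1 // mulr0.
  - by have := v2 g Gg; rewrite pevX sg expr1n => /eqP; rewrite oner_eq0.
  by apply: nphi.
exists (s * c k); split; first by rewrite pevM sg mul1r.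
move=> h Gh; rewrite pevM mulf_eq0 negb_or => /andP[sh ch] phih.
have := ckE h Gh; rewrite phih mulr0 => /esym/eqP.
rewrite mulf_eq0 (negPf ch) orbF expf_eq0 => /andP[_ /eqP Yh].
apply: (can_inj mxvecK); apply/rowP => l; apply/eqP; rewrite -subr_eq0.
by have /eqP := sP l h Gh; rewrite -YE Yh mul0r mulf_eq0 (negPf sh).
Qed.

End IsolatedZeros.

(** * Groups with full tangent space *)

Section PthRoots.
Variables (L : closedFieldType) (N : nat).
Implicit Types q : {mpoly L[N]}.

Lemma msize_mderiv q k : q != 0 -> (msize q^`M(k) < msize q)%N.
Proof.
move=> q0; rewrite [msize q^`M(k)]msizeE [X in (_ < X)%N]mpolySpred // ltnS.
apply/bigmax_leqP_seq => m; rewrite mcoeff_msupp mcoeff_mderiv => cm _.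
have : (m + U_(k))%MM \in msupp q.
  by rewrite mcoeff_msupp; apply: contra cm => /eqP->; rewrite mul0rn.
by move/msize_mdeg_lt; rewrite mdegD mdeg1 addn1 [X in (_ < X)%N -> _]mpolySpred // ltnS.
Qed.

Lemma closed_pth_root (p : nat) (a : L) : (0 < p)%N -> exists x, x ^+ p = a.
Proof.
move=> p0; have [x xE] := solve_monicpoly (fun i => if i == 0%N then a else 0) p0.
exists x; rewrite xE; case: p p0 {xE} => // p _.
rewrite big_ord_recl /= mulr1 big1 ?addr0 // => i _; exact: mul0r.
Qed.

(** Every exponent in the support is zero in [L]. In positive characteristic, divide the exponents
    by [p] and take [p]-th roots of the coefficients; the Frobenius map is additive. *)
Lemma mderiv0_pth_power q : (forall k, q^`M(k) = 0) ->
  (exists c, q = c%:MP) \/ exists p r, p \in [pchar L] /\ q = r ^+ p.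
Proof.
move=> dq.
have expo m k : m \in msupp q -> (m k)%:R = 0 :> L.
  rewrite mcoeff_msupp => cm; case mk: (m k) => [//|j].
  have U : (m - U_(k) + U_(k))%MM = m by rewrite submK // lep1mP mk.
  have := congr1 (mcoeff (m - U_(k))%MM) (dq k).
  rewrite mcoeff0 mcoeff_mderiv U mnmBE mnm1E eqxx mk subSS subn0.
  by rewrite -[_ *+ _]mulr_natr => /eqP; rewrite mulf_eq0 (negPf cm) => /eqP.
case: (classic (exists p, p \in [pchar L])) => [[p pL]|no]; last first.
  left; exists q@_0%MM; apply: msize1_polyC; rewrite msizeE.
  apply/bigmax_leqP_seq => m mq _; rewrite ltnS leqn0 mdeg_eq0.
  apply/eqP/mnmP => k; rewrite mnm0E; apply/eqP.
  apply: contra_notT no; rewrite -lt0n => mk.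
  have [] := natf0_pchar mk (introT eqP (expo m k mq)).
  by move=> p pL; exists p.
right; have p0 := prime_gt0 (pcharf_prime pL).
pose rt a := sval (constructive_indefinite_description _ (closed_pth_root a p0)).
have rtP a := svalP (constructive_indefinite_description _ (closed_pth_root a p0)).
exists p, (\sum_(m <- msupp q) rt q@_m *: 'X_[[multinom (m i %/ p)%N | i < N]]).
split=> //.
have pM : p \in [pchar {mpoly L[N]}].
  by rewrite inE (pcharf_prime pL) /= -mpolyC_nat (pcharf0 pL) mpolyC0.
rewrite -[RHS](pFrobenius_autE pM) rmorph_sum /= [LHS]mpolyE.
rewrite !big_seq; apply: eq_bigr => m mq.
rewrite pFrobenius_autE exprZn rtP mpolyXn; congr (_ *: 'X_[_]).
apply/mnmP => k; rewrite mulmnE mnmE divnK //.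
by rewrite (dvdn_pcharf pL) (expo m k mq).
Qed.

End PthRoots.

(** * Elimination of one coordinate on the special linear group *)

Section FullTangent.
Variables (L : closedFieldType) (n : nat) (G : 'M[L]_n -> Prop).
Hypothesis sG : subgroup G.
Hypothesis G_det : forall A, G A -> \det A = 1.
Hypothesis G_dom : zirreducible G.
Local Notation M := 'M[L]_n.
Local Notation R := {mpoly L[n * n]}.
Implicit Types (p q : R) (A X h : M) (f : M -> L).

Hypothesis G_tan : forall h X, G h -> \tr (invmx h *m X) = 0 -> tangent G h X.
Variable r : 'I_n.

(* [A r r] is the coordinate that the equation [\det A = 1] eliminates. *)
Definition indep f := forall A c, f (A + c *: delta_mx r r) = f A.

Lemma indep_dd q : indep (pev q) -> forall A, pev q^`M(mxvec_index r r) A = 0.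
Proof.
move=> iq A; rewrite -dd_delta; have [s [sE <-]] := pev_line q A (delta_mx r r).
suff -> : s = (pev q A)%:P by rewrite coefC.
by apply: poly_horner_inj => t; rewrite -sE iq hornerC.
Qed.

Lemma indep_mderiv q k : indep (pev q) -> indep (pev q^`M(k)).
Proof.
move=> iq A c; case/mxvec_indexP: k => i j; rewrite -!dd_delta.
have [s [sE <-]] := pev_line q A (delta_mx i j).
have [s' [s'E <-]] := pev_line q (A + c *: delta_mx r r) (delta_mx i j).
suff -> : s' = s by [].
by apply: poly_horner_inj => t; rewrite -sE -s'E addrAC iq.
Qed.

(** Induct on size. The partial derivatives again vanish on [G] and are free of the coordinate
    [(r, r)], so they are zero; then [q] is a constant or a [p]-th power, whose root vanishes on [G]
    as well. *)
Lemma indep_vanish_eq0 q : indep (pev q) -> vanish G q -> q = 0.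
Proof.
have [G1 GM GV] := sG.
have [m] := ubnP (msize q); elim: m q => // m IH q; rewrite ltnS => qm iq vq.
have [->//|q0] := eqVneq q 0.
have adj1 : \adj 1%:M r r != 0 :> L.
  by rewrite -invmx_det1 ?det1 // invmx1 mxE eqxx oner_neq0.
have dq k : q^`M(k) = 0.
  apply: IH; [exact: leq_trans (msize_mderiv k q0) qm|exact: indep_mderiv|].
  case/mxvec_indexP: k => i j.
  have [[-> ->] h _|ij] := eqVneq (i, j) (r, r); first exact: indep_dd.
  have [|||v|//] := @G_dom (fun h => \adj h r r) (pev q^`M(mxvec_index i j)).
  - exact: polymx_adj.
  - exact: polyfun_pev.
  (* This direction has trace zero against [invmx h], hence is tangent. Its second term does not
     change [q], so the first gives [\adj h r r] times the partial derivative. *)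
  - move=> h Gh; have := G_tan (h := h)
      (X := \adj h r r *: delta_mx i j + (- \adj h j i) *: delta_mx r r) Gh.
    rewrite mulmxDr -!scalemxAr mxtraceD !mxtraceZ !mxtrace_mul_delta.
    rewrite invmx_det1 ?G_det // [X in _ + X]mulrC mulrN subrr => /(_ erefl q vq).
    rewrite dd_lin dd_delta -[_ *: _]addr0 dd_lin dd_delta indep_dd //.
    rewrite mulr0 add0r => <-; rewrite [X in _ + X](_ : _ = 0) ?addr0 //.
    by rewrite ddE big1 // => a _; rewrite big1 // => b _; rewrite mxE mulr0.
  - by move: adj1; rewrite v // eqxx.
have [[c qc]|[p [s [pL qs]]]] := mderiv0_pth_power dq.
  by have := vq _ G1; rewrite qc pevC => ->; rewrite mpolyC0.
have p1 := prime_gt1 (pcharf_prime pL).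
have s0 : s != 0 by apply: contra_neq q0 => s0; rewrite qs s0 expr0n -leqn0 leqNgt (ltnW p1).
have vs : vanish G s.
  by move=> A GA; apply/eqP; have /eqP := vq A GA; rewrite qs pevX expf_eq0 => /andP[].
have is_ : indep (pev s).
  move=> A c; apply: (fmorph_inj (pFrobenius_aut pL)).
  by rewrite /= !pFrobenius_autE -!pevX -qs iq.
(* A constant [s] has the same size as its power, so it is treated apart: vanishing at the identity
   makes it zero. *)
case: (posnP (mdeg (mlead s))) => [d0|d0].
  have sc : s = (s@_0)%:MP by apply: msize1_polyC; rewrite -mlead_deg // d0.
  by have := vs _ G1; rewrite sc pevC => c0; rewrite qs sc c0 mpolyC0 expr0n -leqn0 leqNgt (ltnW p1).
suff s_eq0 : s = 0 by rewrite s_eq0 eqxx in s0.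
apply: IH => //; apply: leq_trans qm.
rewrite -!mlead_deg // ltnS qs mleadX // mdegMn.
by rewrite -{1}[mdeg _]muln1 ltn_pmul2l.
Qed.

Lemma cofactor_row (A B : M) k : (forall i j, i != r -> A i j = B i j) ->
  cofactor A r k = cofactor B r k.
Proof.
move=> AB; rewrite /cofactor; congr (_ * \det _); apply/matrixP => i j.
by rewrite !mxE AB // eq_sym neq_lift.
Qed.

Lemma indep_cofactor k : indep (fun A => \adj A k r).
Proof.
move=> A c; rewrite !mxE; apply: cofactor_row => i j ir.
by rewrite !mxE (negPf ir) mulr0 addr0.
Qed.

Lemma det_row_adj A : \det A = \sum_j A r j * \adj A j r.
Proof. by rewrite (expand_det_row _ r); apply: eq_bigr => j _; rewrite mxE. Qed.

(** Where the determinant is 1, expansion along row [r] expresses [\adj A r r * A r r] without the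
    coordinate [(r, r)]; powers of [\adj A r r] clear denominators. *)
Lemma eliminate f : polyfun f -> exists k q, indep (pev q) /\
  forall A, \det A = 1 -> \adj A r r ^+ k * f A = pev q A.
Proof.
pose good f := exists k f', [/\ polyfun f', indep f' &
  forall A, \det A = 1 -> \adj A r r ^+ k * f A = f' A].
suff gd f' : polyfun f' -> good f'.
  move=> /gd[k [f' [/polyfun_mpoly[q qE] i' f'E]]]; exists k, q; split.
    by move=> A c; rewrite !qE.
  by move=> A dA; rewrite f'E.
have padj l : polyfun (fun A : M => \adj A r r ^+ l) by apply: polyfun_exp; apply: polymx_adj.
have iadj l : indep (fun A => \adj A r r ^+ l) by move=> A c; rewrite /= indep_cofactor.
elim=> {f f'} [c|i j|f g _ [k [f' [pf' i_f fE]]] _ [l [g' [pg' i_g gE]]]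
                |f g _ [k [f' [pf' i_f fE]]] _ [l [g' [pg' i_g gE]]]].
- exists 0%N, (fun=> c); split=> // [|A _]; [exact: pf_const|by rewrite mul1r].
- have [[-> ->]|ij] := eqVneq (i, j) (r, r).
    exists 1%N, (fun A => 1 - \sum_(j | j != r) A r j * \adj A j r); split.
    + apply: polyfun_sub; first exact: pf_const.
      by apply: polyfun_sum => k _; apply: pf_mul; [apply: pf_coord | apply: polymx_adj].
    + move=> A c; congr (_ - _); apply: eq_bigr => k kr.
      by rewrite indep_cofactor !mxE (negPf kr) andbF mulr0 addr0.
    + move=> A dA; rewrite expr1 -dA det_row_adj (bigD1 r) //= addrK mulrC //.
  exists 0%N, (fun A => A i j); split=> [|A c|A _]; [exact: pf_coord| |by rewrite mul1r].
  have -> : (A + c *: delta_mx r r) i j = A i j + c * ((i == r) && (j == r))%:R by rewrite !mxE.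
  have -> : (i == r) && (j == r) = false by apply: contraNF ij => /andP[/eqP-> /eqP->].
  by rewrite mulr0 addr0.
- exists (k + l)%N, (fun A => \adj A r r ^+ l * f' A + \adj A r r ^+ k * g' A).
  split=> [|A c|A dA].
  + by apply: pf_add; apply: pf_mul.
  + by rewrite !indep_cofactor i_f i_g.
  + by rewrite -fE // -gE // exprD; ring.
- exists (k + l)%N, (fun A => f' A * g' A); split=> [|A c|A dA].
  + exact: pf_mul.
  + by rewrite i_f i_g.
  + by rewrite -fE // -gE // exprD; ring.
Qed.

Lemma full_tangent_SL : zclosed G -> forall A, \det A = 1 -> G A.
Proof.
have [G1 GM GV] := sG => -[P [Ppoly GP]].
(* The equations of [G] become trivial after elimination, so they hold wherever [\adj A r r] is
   nonzero. *)
have big A : \det A = 1 -> \adj A r r != 0 -> G A.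
  move=> dA Ar; apply/GP => f Pf; have [k [q [iq qE]]] := eliminate (Ppoly f Pf).
  have q0 : q = 0.
    apply: indep_vanish_eq0 => // B GB; rewrite -qE ?G_det //.
    by rewrite (proj1 (GP B) GB f Pf) mulr0.
  apply/eqP; have /eqP := qE A dA; rewrite q0 pev0 mulf_eq0 expf_eq0.
  by rewrite (negPf Ar) andbF.
move=> A dA; have [Ar|/big] := eqVneq (\adj A r r) 0; last exact.
have [j [jr Aj]] : exists j, j != r /\ \adj A j r != 0.
  apply: NNPP => no; have /eqP := dA; rewrite det_row_adj big1 => [|j _].
    by rewrite eq_sym oner_eq0.
  have [->|jr] := eqVneq j r; first by rewrite Ar mulr0.
  suff /eqP-> : \adj A j r == 0 by rewrite mulr0.
  by apply: contra_notT no => nz; exists j.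
(* The transvection [B] lies in [G] by [big]. Right multiplication by it changes the entry [(r, r)]
   of the inverse from 0 to [- \adj A j r], so [big] applies to [A *m B]. *)
pose B : M := 1%:M + delta_mx r j.
have adjB k : \adj B k r = (k == r)%:R.
  have -> : \adj B k r = \adj 1%:M k r.
    rewrite ![\adj _ _ _]mxE; apply: cofactor_row => a b ar.
    by rewrite !mxE (negPf ar) addr0.
  by rewrite -invmx_det1 ?det1 // invmx1 mxE.
have dB : \det B = 1.
  rewrite det_row_adj (bigD1 r) //= big1 => [|k kr]; last by rewrite adjB (negPf kr) mulr0.
  by rewrite adjB !mxE !eqxx eq_sym (negPf jr) !addr0 mulr1.
have uB : B \in unitmx by rewrite unitmxE dB unitr1.
have uA : A \in unitmx by rewrite unitmxE dA unitr1.
have GB : G B by apply: big => //; rewrite adjB eqxx oner_neq0.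
have iB : invmx B = 1%:M - delta_mx r j.
  apply: (can_inj (mulKmx uB)); rewrite mulmxV // mulmxBr mulmx1 mulmxDl mul1mx.
  by rewrite mul_delta_mx_0 // addr0 /B addrK.
have GAB : G (A *m B).
  apply: big; first by rewrite det_mulmx dA dB mulr1.
  rewrite -invmx_det1 ?det_mulmx ?dA ?dB ?mulr1 //.
  have -> : invmx (A *m B) = invmx B *m invmx A.
    have uAB : A *m B \in unitmx by rewrite unitmx_mul uA.
    by apply: (can_inj (mulKmx uAB)); rewrite mulmxV // mulmxA mulmxK // mulmxV.
  rewrite iB mulmxBl mul1mx invmx_det1 // mxE Ar add0r mxE oppr_eq0 mxE (bigD1 j) //=.
  rewrite big1 ?addr0; last by move=> k kj; rewrite mxE (negPf kj) andbF mul0r.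
  by rewrite mxE !eqxx mul1r.
by rewrite -[A](mulmxK uB); apply: GM => //; have [] := GV B GB.
Qed.

End FullTangent.

(** * Symmetric functions of eigenvalues *)

Section CharPoly.
Variables (L : closedFieldType) (n : nat).
Local Notation M := 'M[L]_n.

Definition polypoly (F : M -> {poly L}) := forall k, polyfun (fun A => (F A)`_k).

Lemma polypoly_const c : polypoly (fun=> c).
Proof. by move=> k; apply: pf_const. Qed.

Lemma polypoly_mul F H : polypoly F -> polypoly H -> polypoly (fun A => F A * H A).
Proof.
move=> pF pH k.
apply: (polyfun_ext (f := fun A => \sum_(j < k.+1) (F A)`_j * (H A)`_(k - j))).
  by move=> A; rewrite coefM.
by apply: polyfun_sum => j _; apply: pf_mul.
Qed.

Lemma polypoly_sum (I : Type) (r : seq I) (P : pred I) (F : I -> M -> {poly L}) :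
  (forall i, P i -> polypoly (F i)) -> polypoly (fun A => \sum_(i <- r | P i) F i A).
Proof.
move=> pF k.
apply: (polyfun_ext (f := fun A => \sum_(i <- r | P i) (F i A)`_k)).
  by move=> A; rewrite coef_sum.
by apply: polyfun_sum => i Pi; apply: pF.
Qed.

Lemma polypoly_prod (I : Type) (r : seq I) (F : I -> M -> {poly L}) :
  (forall i, polypoly (F i)) -> polypoly (fun A => \prod_(i <- r) F i A).
Proof.
move=> pF; elim: r => [|i r IH] k.
  by apply: polyfun_ext (polypoly_const 1 k) => A; rewrite big_nil.
by apply: polyfun_ext (polypoly_mul (pF i) IH k) => A; rewrite big_cons.
Qed.

Lemma polyfun_char_poly k : polyfun (fun A : M => (char_poly A)`_k).
Proof.
move: k; apply: polypoly_sum => s _; apply: polypoly_mul; first exact: polypoly_const.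
apply: polypoly_prod => i k.
apply: (polyfun_ext (f := fun A : M => ('X *+ (i == s i))`_k - (A i (s i))%:P`_k)).
  by move=> A; rewrite !mxE coefB.
apply: polyfun_sub; first exact: pf_const.
case: k => [|k]; last by apply: polyfun_ext (pf_const _ 0) => A; rewrite coefC.
by apply: polyfun_ext (pf_coord L i (s i)) => A; rewrite coefC.
Qed.

Lemma char_poly_conj (P A : M) : P \in unitmx ->
  char_poly (P *m A *m invmx P) = char_poly A.
Proof.
move=> uP; rewrite /char_poly.
have -> : char_poly_mx (P *m A *m invmx P) =
    map_mx polyC P *m char_poly_mx A *m map_mx polyC (invmx P).
  rewrite /char_poly_mx mulmxBr mulmxBl -!map_mxM; congr (_ - _).
  by rewrite scalar_mxC -mulmxA -map_mxM mulmxV // map_mx1 mulmx1.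
by rewrite !det_mulmx mulrAC -det_mulmx -map_mxM mulmxV // map_mx1 det1 mul1r.
Qed.

Lemma char_poly_eigs (A : M) : char_poly A = \prod_(x <- eigs A) ('X - x%:P).
Proof.
rewrite /eigs; case: closed_field_poly_normal => s /= e.
by rewrite {1}e (monicP (char_poly_monic A)) scale1r.
Qed.

Lemma size_eigs (A : M) : size (eigs A) = n.
Proof.
have := size_char_poly A; rewrite char_poly_eigs size_prod_XsubC; by case.
Qed.

(** The order in [eigs] is an arbitrary choice, but a symmetric [p] is a polynomial in the
    elementary symmetric functions, which are up to sign the coefficients of [char_poly]. *)
Lemma symmetric_eigs_polyfun (p : {mpoly L[n]}) : p \is symmetric ->
  polyfun (fun A : M => p.@[fun i => (eigs A)`_i]).
Proof.
move=> /sym_fundamental[t [<- _]].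
pose c (i : 'I_n) (A : M) := (-1) ^+ i.+1 * (char_poly A)`_(n - i.+1).
apply: (polyfun_ext
    (f := fun A : M => \sum_(m <- msupp t) t@_m * \prod_i c i A ^+ m i : L)).
  move=> A; rewrite -mevalE comp_mpoly_meval; apply: meval_eq => i.
  rewrite tnth_mktuple /c char_poly_eigs.
  pose cs : n.-tuple L := Tuple (introT eqP (size_eigs A)).
  have := mroots_coeff cs (lift ord0 i); rewrite /= /bump add1n => ->.
  rewrite mulrA -exprD addnn -signr_odd odd_double mul1r.
  by apply: meval_eq => j; rewrite (tnth_nth 0).
apply: polyfun_sum => m _; apply: pf_mul; first exact: pf_const.
apply: polyfun_prod => i _; apply: polyfun_exp.
by apply: pf_mul; [apply: pf_const | apply: polyfun_char_poly].
Qed.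

End CharPoly.

(** * The polynomial behind [Fsym] and its nonvanishing *)

Section SymmetricProducts.
Variables (L : closedFieldType) (n : nat).

Lemma msym_var (s : 'S_n) i : msym s ('X_i : {mpoly L[n]}) = 'X_(s i).
Proof. by rewrite /msym mmapX mmap1U. Qed.

Lemma symmetric_prod k (F : {ffun 'I_k -> 'I_n} -> {mpoly L[n]}) :
  (forall (s : 'S_n) t, msym s (F t) = F [ffun x => s (t x)]) ->
  \prod_(t : {ffun 'I_k -> 'I_n} | injectiveb t) F t \is symmetric.
Proof.
move=> Fs; apply/issymP => s.
pose c (s : 'S_n) (t : {ffun 'I_k -> 'I_n}) := [ffun x => s (t x)].
have cK (s' : 'S_n) : cancel (c s'^-1%g) (c s').
  by move=> t; apply/ffunP => x; rewrite !ffunE permKV.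
have cK' (s' : 'S_n) : cancel (c s') (c s'^-1%g).
  by move=> t; apply/ffunP => x; rewrite !ffunE permK.
rewrite rmorph_prod /= [RHS](reindex (c s)) /=; last first.
  by exists (c s^-1%g) => t _; [apply: cK' | apply: cK].
apply: eq_big => [t|t _]; last exact: Fs.
apply/injectiveP/injectiveP => inj x y.
  by rewrite !ffunE => /perm_inj/inj.
by move=> e; apply: inj; rewrite !ffunE e.
Qed.

Definition tvar k (t : {ffun 'I_k.+1 -> 'I_n}) (j : nat) : {mpoly L[n]} :=
  'X_(t (inord j)).

Lemma msym_tvar k (s : 'S_n) (t : {ffun 'I_k.+1 -> 'I_n}) j :
  msym s (tvar t j) = tvar [ffun x => s (t x)] j.
Proof. by rewrite /tvar msym_var ffunE. Qed.

Definition Fpoly : {mpoly L[n]} :=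
  (\prod_(t : {ffun 'I_2 -> 'I_n} | injectiveb t) (tvar t 0 - tvar t 1)) *
  (\prod_(t : {ffun 'I_3 -> 'I_n} | injectiveb t)
      (tvar t 0 * tvar t 1 - tvar t 2 ^+ 2)) *
  (\prod_(t : {ffun 'I_4 -> 'I_n} | injectiveb t)
      (tvar t 0 * tvar t 1 - tvar t 2 * tvar t 3)) *
  (\prod_(t : {ffun 'I_6 -> 'I_n} | injectiveb t)
      (tvar t 0 * tvar t 1 * tvar t 2 - tvar t 3 * tvar t 4 * tvar t 5)).

Lemma Fpoly_sym : Fpoly \is symmetric.
Proof.
rewrite /Fpoly !rpredM // symmetric_prod // => s t;
  by rewrite ?expr2 !(msymB, msymM, msym_tvar).
Qed.

Lemma Fpoly_eval (s : seq L) : Fpoly.@[fun i => s`_i] = Fsym n s.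
Proof.
rewrite /Fpoly /Fsym !mevalM !rmorph_prod /=; congr (_ * _ * _ * _);
  by apply: eq_bigr => t _; rewrite mevalB ?rmorphXn /= ?mevalM /= ?mevalXU.
Qed.

(** Complements [Fpoly], in which no factor compares [a_i ^+ 2] with [a_j ^+ 2]: excluding
    [a_i = - a_j] separates the ratios [a_i / a_j] and [a_j / a_i]. *)
Definition Spoly : {mpoly L[n]} :=
  \prod_(t : {ffun 'I_2 -> 'I_n} | injectiveb t) (tvar t 0 + tvar t 1).

Lemma Spoly_sym : Spoly \is symmetric.
Proof. by apply: symmetric_prod => s t; rewrite rmorphD /= !msym_tvar. Qed.

Lemma Spoly_eval (s : seq L) : Spoly.@[fun i => s`_i] =
  \prod_(t : {ffun 'I_2 -> 'I_n} | injectiveb t) (s`_(t (inord 0)) + s`_(t (inord 1))).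
Proof. by rewrite /Spoly rmorph_prod; apply: eq_bigr => t _; rewrite rmorphD /= !mevalXU. Qed.

Lemma index_tuple (k : nat) (l : seq 'I_n) : uniq l -> size l = k.+1 ->
  exists t : {ffun 'I_k.+1 -> 'I_n}, injectiveb t /\
    forall (x0 : 'I_n) j, (j < k.+1)%N -> t (inord j) = nth x0 l j.
Proof.
case: l => // x l ul sl; exists [ffun j : 'I_k.+1 => nth x (x :: l) j]; split.
  apply/injectiveP => i j; rewrite !ffunE => /eqP.
  by rewrite nth_uniq ?sl // => /eqP/val_inj.
move=> x0 j jk; rewrite ffunE inordK //; apply: set_nth_default; by rewrite sl.
Qed.

Lemma Fsym_neq0 (s : seq L) : Fsym n s != 0 ->
  [/\ forall i j : 'I_n, i != j -> s`_i != s`_j,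
      forall i j k : 'I_n, uniq [:: i; j; k] -> s`_i * s`_j != s`_k ^+ 2 &
      forall i j k l : 'I_n, uniq [:: i; j; k; l] -> s`_i * s`_j != s`_k * s`_l].
Proof.
rewrite /Fsym !mulf_eq0 !negb_or => /andP[/andP[/andP[f2 f3] f4] _].
split=> [i j ij|i j k ijk|i j k l ijkl].
- have [|//|t [tinj tE]] := @index_tuple 1 [:: i; j]; first by rewrite /= inE ij.
  have /prodf_neq0/(_ t tinj) := f2; rewrite !(tE i) //= subr_eq0 //.
- have [//|//|t [tinj tE]] := @index_tuple 2 [:: i; j; k].
  have /prodf_neq0/(_ t tinj) := f3; rewrite !(tE i) //= subr_eq0 //.
have [//|//|t [tinj tE]] := @index_tuple 3 [:: i; j; k; l].
have /prodf_neq0/(_ t tinj) := f4; rewrite !(tE i) //= subr_eq0 //.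
Qed.

Lemma Spoly_neq0 (s : seq L) : Spoly.@[fun i => s`_i] != 0 ->
  forall i j : 'I_n, i != j -> s`_i + s`_j != 0.
Proof.
rewrite Spoly_eval => /prodf_neq0 f i j ij.
have [|//|t [tinj tE]] := @index_tuple 1 [:: i; j]; first by rewrite /= inE ij.
by have := f t tinj; rewrite !(tE i).
Qed.

End SymmetricProducts.

(** * Proof of the theorem *)

Section Diagonalization.
Variables (L : closedFieldType) (n : nat).
Local Notation M := 'M[L]_n.

Lemma char_poly_diag (d : 'rV[L]_n) :
  char_poly (diag_mx d) = \prod_(x <- [seq d 0 i | i <- enum 'I_n]) ('X - x%:P).
Proof.
rewrite char_poly_trig ?diag_mx_is_trig // big_map big_enum.
by apply: eq_bigr => i _; rewrite mxE eqxx.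
Qed.

Lemma perm_eigs_diag (P A : M) d : P \in unitmx ->
  P *m A *m invmx P = diag_mx d -> perm_eq [seq d 0 i | i <- enum 'I_n] (eigs A).
Proof.
move=> uP e; apply: prod_XsubC_eq.
by rewrite -char_poly_diag -e char_poly_conj // char_poly_eigs.
Qed.

(** The minimal polynomial divides the characteristic polynomial, which is a product of distinct
    linear factors. *)
Lemma distinct_eigs_diag (A : M) : uniq (eigs A) ->
  exists P d, P \in unitmx /\ P *m A *m invmx P = diag_mx d.
Proof.
case: n A => [A _|m A uA].
  by exists 1%:M, 0; split; [apply: unitmx1 | apply/matrixP => -[]].
have [P uP /diag_mxP[d dE]] : diagonalizable A.
  apply/diagonalizableP; exists (eigs A) => //.
  by rewrite -char_poly_eigs mxminpoly_dvd_char.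
by exists P, d; split=> //; rewrite -conjumx.
Qed.

End Diagonalization.

Section DiagonalElement.
Variables (L : closedFieldType) (n : nat) (G : 'M[L]_n -> Prop).
Hypothesis n2 : (2 <= n)%N.
Hypothesis sG : subgroup G.
Hypothesis G_det : forall A, G A -> \det A = 1.
Hypothesis G_dom : zirreducible G.
Hypothesis G_irr : taut_irreducible G.
Local Notation M := 'M[L]_n.
Variable d : 'rV[L]_n.
Hypothesis Gd : G (diag_mx d).
Hypothesis d_inj : forall i j, i != j -> d 0 i != d 0 j.

(** What commutes with a diagonal matrix with distinct entries is diagonal, whereas an off-diagonal
    entry is nonzero somewhere on [G]. *)
Lemma diag_not_central :
  ~ (forall h, G h -> h *m diag_mx d = diag_mx d *m h).
Proof.
move=> comm; pose i0 : 'I_n := Ordinal (ltnW n2); pose i1 : 'I_n := Ordinal n2.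
have [h [Gh /negP[]]] := entry_neq0 sG G_irr i0 i1.
have := congr1 (fun Y : M => Y i0 i1) (comm h Gh).
rewrite mul_mx_diag mul_diag_mx !mxE [RHS]mulrC => /eqP.
by rewrite -subr_eq0 -mulrBr mulf_eq0 subr_eq0 (negPf (d_inj _)) ?orbF // => ->.
Qed.

Lemma tangent_nonscalar : exists X, tangent G 1%:M X /\ forall c, X != c%:M.
Proof.
have [G1 GM GV] := sG.
apply: NNPP => none; pose g : M := diag_mx d.
have tg X : tangent G g X -> exists c, X = c *: g.
  move=> /(tangent1_translate sG X Gd) tX; apply: NNPP => no; apply: none.
  exists (invmx g *m X); split=> // c; apply: contra_notN no => /eqP e.
  by exists c; rewrite -[X](mulKVmx (proj1 (GV _ Gd))) e mul_mx_scalar.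
pose i0 : 'I_n := Ordinal (ltnW n2); pose i1 : 'I_n := Ordinal n2.
(* Equal characteristic polynomials would make every [d 0 i] equal to 1, contradicting
   distinctness. *)
have [k ck] : exists k, (char_poly g)`_k != (char_poly (1%:M : M))`_k.
  apply: NNPP => no.
  have e : char_poly g = char_poly (1%:M : M).
    by apply/polyP => k; apply/eqP; apply: contra_notT no => nz; exists k.
  have r1 i : d 0 i = 1.
    have : root (char_poly (1%:M : M)) (d 0 i).
      rewrite -e /g char_poly_diag root_prod_XsubC.
      by apply/mapP; exists i; rewrite ?mem_enum.
    rewrite -diag_const_mx char_poly_diag root_prod_XsubC => /mapP[j _ ->].
    by rewrite mxE.
  by have := @d_inj i0 i1 isT; rewrite !r1 eqxx.
have [phi phiE] : exists phi, forall A : M, pev phi A = (char_poly A)`_k - (char_poly g)`_k.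
  apply: polyfun_mpoly; apply: polyfun_sub; first exact: polyfun_char_poly.
  exact: pf_const.
have g00 : mxvec g 0 (mxvec_index i0 i0) != 0.
  by rewrite mxvecE mxE eqxx mulr1n (d_neq0 G_det Gd).
have [||s [sg sP]] := isolated_zero G_dom Gd g00 tg (phi := phi).
- by rewrite phiE subrr.
- by move=> /(_ _ G1)/eqP; rewrite phiE subr_eq0 eq_sym (negPf ck).
apply: diag_not_central => h Gh; apply/matrixP => i j.
pose F (A : M) := A *m g *m \adj A.
have pF : polymx F.
  apply: polymx_mul; last exact: polymx_adj.
  by apply: polymx_mul; [apply: polymx_id | apply: polymx_const].
(* Conjugates of [g] are zeros of [phi], so those with [s] nonzero equal [g]. Hence [A] commutes
   with [g] where [s (F A)] is nonzero, in particular near 1, and by irreducibility on all of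
   [G]. *)
have [|||v|v] := @G_dom (fun A => pev s (F A))
                       (fun A => (A *m g) i j - (g *m A) i j).
- exact: polyfun_comp (polyfun_pev s) pF.
- apply: polyfun_sub.
    by apply: polymx_mul; [apply: polymx_id | apply: polymx_const].
  by apply: polymx_mul; [apply: polymx_const | apply: polymx_id].
- move=> A GA; have [uA GA'] := GV A GA.
  have [->|sA] := eqVneq (pev s (F A)) 0; first by rewrite mul0r.
  have FA : F A = A *m g *m invmx A by rewrite invmx_det1 ?G_det.
  have FAg : F A = g.
    apply: sP => //; first by rewrite FA; exact: GM (GM _ _ GA Gd) GA'.
    by rewrite phiE FA char_poly_conj // subrr.
  have -> : A *m g = g *m A by rewrite -[A *m g](mulmxKV uA) -FA FAg.
  by rewrite subrr mulr0.
- move: sg; have := v _ G1; rewrite /F mul1mx -invmx_det1 ?det1 // invmx1 mulmx1 => ->.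
  by rewrite eqxx.
by apply/eqP; rewrite -subr_eq0 v.
Qed.

Hypothesis d_ratio : forall i j k l, i != j -> k != l -> (i, j) != (k, l) ->
  d 0 i * d 0 l != d 0 k * d 0 j.

Lemma diagonal_element_SL : zclosed G -> forall A, \det A = 1 -> G A.
Proof.
have [G1 GM GV] := sG.
pose i0 : 'I_n := Ordinal (ltnW n2).
have [X [tX nX]] := tangent_nonscalar.
have [h [Gh ndiag]] : exists h, G h /\ ~~ is_diag_mx (h *m X *m invmx h).
  apply: NNPP => no; have [h Gh|c Xc] := conj_diag_scalar sG G_det G_dom G_irr i0 (X := X).
    by apply: contra_notT no => nd; exists h.
  by have := nX c; rewrite Xc eqxx.
have [k [l [kl hkl]]] : exists k l, k != l /\ (h *m X *m invmx h) k l != 0.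
  apply: NNPP => no; move/negP: ndiag; apply; apply/is_diag_mxP => k l kl.
  by apply/eqP; apply: contra_notT no => nz; exists k, l.
have tall := tangent_delta_all sG G_det G_dom G_irr Gd d_inj d_ratio
  (tangent_conj sG Gh tX) kl hkl.
apply: (full_tangent_SL sG G_det G_dom _ i0) => h' Y Gh' trY.
exact (proj2 (tangent1_translate sG Y Gh')
  (tangent_sl sG G_det G_dom G_irr kl tall trY)).
Qed.

End DiagonalElement.

Section RegularElement.
Variables (L : closedFieldType) (n : nat) (G : 'M[L]_n -> Prop).
Hypothesis n2 : (2 <= n)%N.
Hypothesis G1 : G 1%:M.
Hypothesis G_dom : zirreducible G.

Lemma generic_element : (exists g, G g /\ fmorph g != 0) ->
  exists g, [/\ G g, fmorph g != 0 &
    forall i j : 'I_n, i != j -> (eigs g)`_i + (eigs g)`_j != 0].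
Proof.
move=> [g [Gg fg]].
(* In characteristic 2 the condition on sums is part of the first factor of [Fsym]. *)
have [two0|two] := eqVneq (2 : L) 0.
  exists g; split=> // i j ij; have [f2 _ _] := Fsym_neq0 fg.
  have opp (x : L) : - x = x by apply/eqP; rewrite eq_sym -addr_eq0 -mulr2n -mulr_natr two0 mulr0.
  by rewrite -[(eigs g)`_j]opp subr_eq0 f2.
apply: NNPP => no.
have [|||v|v] := @G_dom (fun A => (Fpoly L n).@[fun i => (eigs A)`_i])
                       (fun A => (Spoly L n).@[fun i => (eigs A)`_i]).
- exact: symmetric_eigs_polyfun (Fpoly_sym L n).
- exact: symmetric_eigs_polyfun (Spoly_sym L n).
- move=> A GA; apply/eqP; apply: contra_notT no.
  rewrite mulf_eq0 negb_or Fpoly_eval => /andP[fA SA].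
  by exists A; split=> //; apply: Spoly_neq0.
- by have /eqP := v g Gg; rewrite Fpoly_eval (negPf fg).
(* At the identity [Spoly] is a power of 2, so outside characteristic 2 it does not vanish
   identically on [G]. *)
have e1 i : (i < n)%N -> (eigs (1%:M : 'M[L]_n))`_i = 1.
  move=> lt; have : (eigs (1%:M : 'M[L]_n))`_i \in eigs (1%:M : 'M[L]_n).
    by rewrite mem_nth ?size_eigs.
  rewrite -root_prod_XsubC -char_poly_eigs -diag_const_mx char_poly_diag root_prod_XsubC.
  by case/mapP => j _ ->; rewrite mxE.
have /eqP := v _ G1; rewrite Spoly_eval; apply/negP/prodf_neq0 => t _.
by rewrite !e1.
Qed.

End RegularElement.

Lemma taut_irreducible_conj (L : closedFieldType) n (G : 'M[L]_n -> Prop) P :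
  P \in unitmx -> taut_irreducible G ->
  taut_irreducible (fun A => G (invmx P *m A *m P)).
Proof.
move=> uP irr U UG.
have uPT : P^T \in unitmx by rewrite unitmx_tr.
have [g Gg|U0|Ufull] := irr (U *m invmx P^T).
- have := UG (P *m g *m invmx P); rewrite !mulmxA mulVmx // mul1mx mulmxKV // => /(_ Gg).
  move/(submxMr (invmx P^T)); rewrite !trmx_mul trmx_inv !mulmxA.
  by rewrite -[X in (X <= _)%MS]mulmxA mulmxV // mulmx1.
- by left; rewrite -[U](mulmxKV uPT) U0 mul0mx.
right; rewrite -[U](mulmxKV uPT) /row_full; apply/eqP.
by rewrite mxrankMfree ?row_free_unit //; apply/eqP.
Qed.

Theorem mainTheorem5 (L : closedFieldType) (n : nat) (G : 'M[L]_n -> Prop) :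
  (2 <= n)%N ->
  alg_subgroup_SL G -> zconnected G -> semisimple G ->
  taut_irreducible G ->
  (exists g, G g /\ fmorph g != 0) ->
  forall A : 'M[L]_n, \det A = 1 -> G A.
Proof.
move=> n2 [sG clG G_det] cG _ irrG exg A dA.
have G_dom := zconnected_irreducible sG cG.
have [G1 GM GV] := sG.
have [g [Gg fg Sg]] := generic_element G1 G_dom exg.
have [f2 f3 f4] := Fsym_neq0 fg.
have us : uniq (eigs g).
  apply/(uniqP 0) => i j; rewrite !inE size_eigs => li lj e; apply/eqP.
  by apply: contraT => ij; have := f2 (Ordinal li) (Ordinal lj) ij; rewrite e eqxx.
have [P [d [uP Pd]]] := distinct_eigs_diag us.
have perm := perm_eigs_diag uP Pd.
have d_mem i : d 0 i \in eigs g.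
  by rewrite -(perm_mem perm); apply/mapP; exists i; rewrite ?mem_enum.
have dlt i : (index (d 0%R i) (eigs g) < n)%N by rewrite -[X in (_ < X)%N](size_eigs g) index_mem.
(* The position of [d 0 i] in [eigs g]; its injectivity transfers the inequalities between
   eigenvalues to [d]. *)
pose s i := Ordinal (dlt i).
have sE i : d 0 i = (eigs g)`_(s i) by rewrite nth_index.
have d_injective : injective (fun i => d 0 i).
  by apply/injectiveP; rewrite /injectiveb /dinjectiveb (perm_uniq perm).
have s_inj : injective s by move=> i j e; apply: d_injective; rewrite /= !sE e.
have d_inj i j : i != j -> d 0 i != d 0 j by rewrite (inj_eq d_injective).
(* Pass to the conjugate [H] of [G], which contains [diag_mx d]. *)
pose cj (B : 'M[L]_n) := invmx P *m B *m P.
pose H B := G (cj B).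
have cjM (B C : 'M[L]_n) : cj (B *m C) = cj B *m cj C.
  by rewrite /cj !mulmxA mulmxK //.
have cj1 : cj 1%:M = 1%:M by rewrite /cj mulmx1 mulVmx.
have cjK B : P *m cj B *m invmx P = B by rewrite /cj !mulmxA mulmxV // mul1mx mulmxK.
have cjK' B : cj (P *m B *m invmx P) = B by rewrite /cj !mulmxA mulVmx // mul1mx mulmxKV.
have pcj : polymx cj.
  apply: polymx_mul; last exact: polymx_const.
  by apply: polymx_mul; [apply: polymx_const | apply: polymx_id].
have pcjV : polymx (fun B : 'M[L]_n => P *m B *m invmx P).
  apply: polymx_mul; last exact: polymx_const.
  by apply: polymx_mul; [apply: polymx_const | apply: polymx_id].
have det_cj B : \det (cj B) = \det B.
  by rewrite /cj !det_mulmx mulrAC -det_mulmx mulVmx // det1 mul1r.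
have det_cjV B : \det (P *m B *m invmx P) = \det B.
  by rewrite !det_mulmx mulrAC -det_mulmx mulmxV // det1 mul1r.
have sH : subgroup H.
  split=> [|B C HB HC|B HB]; first by rewrite /H cj1.
    by rewrite /H cjM; apply: GM.
  have [uB GB] := GV _ HB.
  have uB' : B \in unitmx by move: uB; rewrite !unitmxE det_cj.
  split=> //; rewrite /H; suff -> : cj (invmx B) = invmx (cj B) by [].
  by apply: (can_inj (mulKmx uB)); rewrite -cjM !mulmxV.
have H_dom : zirreducible H.
  move=> f h pf ph fh.
  have [|||v|v] := G_dom (fun B => f (P *m B *m invmx P)) (fun B => h (P *m B *m invmx P)).
  - exact: polyfun_comp pf pcjV.
  - exact: polyfun_comp ph pcjV.
  - by move=> B GB; apply: fh; rewrite /H cjK'.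
  - by left=> B /v; rewrite cjK.
  - by right=> B /v; rewrite cjK.
have clH : zclosed H.
  have [Q [Qp QG]] := clG; exists (fun f => exists q, Q q /\ f = fun B => q (cj B)).
  split=> [_ [q [Qq ->]]|B]; first exact: polyfun_comp (Qp q Qq) pcj.
  split=> [/QG HB _ [q [Qq ->]]|HB]; first exact: HB.
  by apply/QG => q Qq; apply: (HB (fun B => q (cj B))); exists q.
rewrite -(cjK' A); apply: (@diagonal_element_SL L n H n2 sH _ H_dom _ d).
- by move=> B HB; rewrite -det_cj G_det.
- exact: taut_irreducible_conj.
- by rewrite /H -Pd cjK'.
- exact: d_inj.
- move=> i j k l ij kl ijkl.
  have dn0 a : d 0 a != 0.
    have := oner_neq0 L; rewrite -(G_det _ Gg) -(det_cjV g) Pd det_diag.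
    by apply: contra => /eqP da; rewrite (bigD1 a) //= da mul0r.
  have d2 a b : a != b -> d 0 a * d 0 a != d 0 b * d 0 b.
    move=> ab; rewrite -!expr2 -subr_eq0 subr_sqr mulf_neq0 //.
      by rewrite subr_eq0 d_inj.
    by rewrite !sE Sg // (inj_eq s_inj).
  have d3 a b c : a != b -> a != c -> b != c -> d 0 a * d 0 b != d 0 c * d 0 c.
    move=> ab ac bc; rewrite -expr2 !sE f3 //= !inE !(inj_eq s_inj) negb_or ab ac bc //.
  (* Cancel a common factor if [i = k] or [j = l]. Otherwise [i = l] and [j = k] together compare
     two squares, exactly one of them a square with a product (three indices), and neither leaves
     four distinct indices. *)
  have [ik|ik] := eqVneq i k.
    rewrite -ik (inj_eq (mulfI (dn0 i))) d_inj //.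
    by move: ijkl; rewrite ik xpair_eqE eqxx /= eq_sym.
  have [jl|jl] := eqVneq j l; first by rewrite jl (inj_eq (mulIf (dn0 l))) d_inj.
  have [il|il] := eqVneq i l.
    rewrite -il; have [jk|jk] := eqVneq j k; first by rewrite jk d2.
    by rewrite eq_sym d3 // eq_sym.
  have [jk|jk] := eqVneq j k; first by rewrite jk d3 // eq_sym.
  rewrite !sE f4 //= !inE !(inj_eq s_inj) !negb_or.
  by rewrite il ik ij [l == k]eq_sym kl [l == j]eq_sym jl [k == j]eq_sym jk.
- exact: clH.
by rewrite det_cjV.
Qed.
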